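(* Fix $\eta\in\mathbb R$ and $R>0$. Under the admissible-strip assumption (A) and the bounded-strip Riccati regularity assumption (B) stated in the context, there exist a coefficient $C_{\mathrm{Ric}}(\alpha)\ge0$ and a constant $C_{\eta,R,T}>0$ (not depending on $\tau$) such that $$\sup_{0\le n\le N_\tau}\ \sup_{z\in\Gamma_{\eta,R}}\left|H_n^\tau(z)-h(t_n,z)\right|\le C_{\eta,R,T}\tau^{-\alpha}+C_{\mathrm{Ric}}(\alpha)\tau^{-(1-\alpha)},$$ with $C_{\mathrm{Ric}}(\alpha)\to0$ as $\alpha\uparrow1^-$.
   Context: Parameters. $\alpha\in(1/2,1)$, $\beta>1$, $\gamma,\mu,\xi_0,\theta>0$, $V_0=\theta\xi_0$, $T>0$; $\rho=\frac{1-\beta}{\sqrt{2(1+\beta^2)}}$, $\nu=\sqrt{\frac{\theta(1+\beta^2)}{\gamma\mu(1+\beta)^2}}$. For integers $\tau$ (large enough that $a_\tau\in(0,1)$): $\varepsilon_\tau=\gamma\tau^{-\alpha}$, $a_\tau=1-\varepsilon_\tau$, $\mu_\tau=\mu\tau^{\alpha-1}$, $N_\tau=\lfloor\tau T\rfloor$, $t_n=n/\tau$, $c_\tau=\sqrt{\frac{\theta\varepsilon_\tau}{2\mu\tau^\alpha}}$, $d_\tau=\frac{\theta\varepsilon_\tau}{2\mu\tau^\alpha}$. Constants may depend on $(\eta,R,T)$ and the model parameters, but not on $(n,\tau,z)$. Discrete side. $\varphi_1=1-\frac1{\Gamma(1-\alpha)}$, $\varphi_n=\frac1{\Gamma(1-\alpha)}\big((n-1)^{-\alpha}-n^{-\alpha}\big)$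 for $n\ge2$, $\varphi_n^\tau=a_\tau\varphi_n$; $q_k^{\tau,+}=\frac{\varphi_k^\tau}{1+\beta}$, $q_k^{\tau,-}=\frac{\beta\varphi_k^\tau}{1+\beta}$; $\Theta_+^\tau(z)=z(c_\tau-d_\tau)$, $\Theta_-^\tau(z)=-zc_\tau$. For $n\ge0$ (empty sums are zero), $$G_n^\tau(z)=\exp\Big(\Theta_+^\tau(z)+\sum_{k=1}^nq_k^{\tau,+}G_{n-k}^\tau(z)\Big)+\exp\Big(\Theta_-^\tau(z)+\sum_{k=1}^nq_k^{\tau,-}G_{n-k}^\tau(z)\Big)-2,\qquad H_n^\tau(z):=\frac{\mu}{\theta\varepsilon_\tau}G_n^\tau(z).$$ Continuous side. $h(\cdot,z)$ solves the fractional Riccati equation in Volterra form $$h(t,z)=\frac1{\Gamma(\alpha)}\int_0^t(t-s)^{\alpha-1}\Big[\tfrac12(z^2-z)+\gamma(\rho\nu z-1)h(s,z)+\tfrac{(\gamma\nu)^2}2h(s,z)^2\Big]ds.$$ Transforms. $\hat\mu_\tau(n)=\mu_\tau+\xi_0\mu_\tau\big(\frac1{1-a_\tau}(1-\sum_{s=1}^{n-1}\varphi_s^\tau)-\sum_{s=1}^{n-1}\varphi_s^\tau\big)$. Given the past, $X_n^{\tau,\pm}$ are independent Poisson variables, both with mean $\hat\mu_\tau(n)+\frac1{1+\beta}\sum_{s=1}^{n-1}\varphi^\tau_{n-s}(X_s^{\tau,+}+\beta X_s^{\tau,-})$; $N_n^{\tau,\pm}=\sum_{s\le n}X_s^{\tau,\pm}$;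 $P_T^\tau=c_\tau(N_{N_\tau}^{\tau,+}-N_{N_\tau}^{\tau,-})-d_\tau N_{N_\tau}^{\tau,+}$; $\Phi^\tau(z,T)=\mathbb E[e^{zP_T^\tau}]$. The rough Heston log-price is $P_T=\int_0^T\sqrt{V_s}\,dW^X_s-\frac12\int_0^TV_s\,ds$ with $V_t=V_0+\frac{\gamma}{\Gamma(\alpha)}\int_0^t(t-s)^{\alpha-1}(\theta-V_s)\,ds+\frac{\gamma\nu}{\Gamma(\alpha)}\int_0^t(t-s)^{\alpha-1}\sqrt{V_s}\,dW^V_s$, $d\langle W^X,W^V\rangle_t=\rho\,dt$; $\phi(z,T)=\mathbb E[e^{zP_T}]$. (A) There is a nonempty open vertical strip $\mathcal S_T=\{z\in\mathbb C:\underline\eta_T<\mathrm{Re}\,z<\overline\eta_T\}$ on which $\phi(z,T)$ and $\Phi^\tau(z,T)$ are finite and analytic for all sufficiently large $\tau$. (B) $\Gamma_{\eta,R}:=\{\eta+\mathrm i\xi:|\xi|\le R\}\subset\mathcal S_T$ and $\sup_{z\in\Gamma_{\eta,R}}\sup_{0\le t\le T}|h(t,z)|<\infty$. *)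

(* Defs.v *)
From HB Require Import structures.
From mathcomp Require Import all_boot all_order all_algebra.
From mathcomp Require Import complex.
From mathcomp Require Import all_classical all_reals all_analysis.

Set Implicit Arguments.
Unset Strict Implicit.
Unset Printing Implicit Defensive.

Import Order.TTheory GRing.Theory Num.Theory.
Import numFieldNormedType.Exports.
Import Normc.

Notation Re := complex.Re.
Notation Im := complex.Im.

Local Open Scope classical_set_scope.
Local Open Scope ring_scope.
Local Open Scope complex_scope.

Section Analysis.
Context {R : realType}.
Implicit Types (z : R[i]) (f : R -> R[i]).

Definition Gamma (a : R) : R :=
  \int[lebesgue_measure]_(t in `[0, +oo[) (t `^ (a - 1) * expR (- t)).

Definition cexp z : R[i] :=
  (expR (Re z) * cos (Im z)) +i* (expR (Re z) * sin (Im z)).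

Definition cintegrable (D : set R) f : Prop :=
  lebesgue_measure.-integrable D (fun s => (Re (f s))%:E) /\
  lebesgue_measure.-integrable D (fun s => (Im (f s))%:E).

Definition cintegral (D : set R) f : R[i] :=
  (\int[lebesgue_measure]_(s in D) Re (f s)) +i*
  (\int[lebesgue_measure]_(s in D) Im (f s)).

Definition analytic_at (g : R[i] -> R[i]) (z0 : R[i]) : Prop :=
  exists (a : nat -> R[i]) (r : R), 0 < r /\
    forall z, normc (z - z0) < r ->
      normc (\sum_(k < n) a k * (z - z0) ^+ k - g z) @[n --> \oo] --> (0 : R).

Definition strip (lo hi : \bar R) : set R[i] :=
  [set z | (lo < (Re z)%:E)%E /\ ((Re z)%:E < hi)%E].

Definition segment (eta r : R) : set R[i] :=
  [set z | Re z = eta /\ `|Im z| <= r].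

End Analysis.

Section Stochastic.
Context {R : realType} {d : measure_display} {Om : measurableType d}.
Variable P : probability Om R.
Implicit Types (F : R -> set (set Om)) (W H : R -> Om -> R) (I X : Om -> R).

Definition exp_moment_finite X (z : R[i]) : Prop :=
  measurable_fun setT X /\
  P.-integrable setT (fun w => (expR (Re z * X w))%:E).

(* E[e^{zX}] *)
Definition exp_moment X (z : R[i]) : R[i] :=
  (\int[P]_w Re (cexp (z * (X w)%:C))) +i*
  (\int[P]_w Im (cexp (z * (X w)%:C))).

Definition cvg_in_probability (Z : nat -> Om -> R) X : Prop :=
  forall del : R, 0 < del ->
    P [set w | del <= `|Z n w - X w|] @[n --> \oo] --> 0%E.

Definition filtration F : Prop :=
  [/\ forall t, sigma_algebra setT (F t),
      forall t, F t `<=` measurable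
    & forall s t, s <= t -> F s `<=` F t].

Definition measurable_wrt (G : set (set Om)) X : Prop :=
  forall B : set R, measurable B -> G (X @^-1` B).

Definition adapted F (T : R) H : Prop :=
  forall t, 0 <= t <= T -> measurable_wrt (F t) (H t).

Definition continuous_paths (T : R) H : Prop :=
  forall w, {within `[0, T], continuous (fun t => H t w)}.

(* F-Brownian motion on [0, T]: the last field says that W t - W s is
   independent of F s with law N(0, t - s). *)
Record brownian_motion F (T : R) W : Prop := BrownianMotion {
  bm_adapted : adapted F T W;
  bm_continuous : continuous_paths T W;
  bm_start : forall w, W 0 w = 0;
  bm_increments : forall s t, 0 <= s -> s < t -> t <= T ->
    forall A, F s A -> forall B : set R, measurable B ->
      P (A `&` [set w | B (W t w - W s w)]) =
        (P A * normal_prob 0 (Num.sqrt (t - s)) B)%E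
}.

Definition covariation (T : R) W W' (rho : R) : Prop :=
  forall t, 0 <= t <= T ->
    let u (n i : nat) : R := t * i%:R / n%:R in
    cvg_in_probability
      (fun n w => \sum_(i < n) (W (u n i.+1) w - W (u n i) w)
                             * (W' (u n i.+1) w - W' (u n i) w))
      (fun=> rho * t).

(* sum_{i < sp_size} sp_coef i * 1_(sp_time i, sp_time i.+1] *)
Record simple_process := SimpleProcess {
  sp_size : nat;
  sp_time : nat -> R;
  sp_coef : nat -> Om -> R
}.

Definition simple_predictable F (t : R) (S : simple_process) : Prop :=
  forall i, (i < sp_size S)%N ->
    [/\ 0 <= sp_time S i, sp_time S i <= sp_time S i.+1,
        sp_time S i.+1 <= t,
        measurable_wrt (F (sp_time S i)) (sp_coef S i)
      & exists b : R, forall w, `|sp_coef S i w| <= b].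

Definition simple_value (S : simple_process) (s : R) (w : Om) : R :=
  \sum_(i < sp_size S)
    sp_coef S i w * \1_(`]sp_time S i, sp_time S i.+1]) s.

Definition simple_integral W (S : simple_process) (w : Om) : R :=
  \sum_(i < sp_size S)
    sp_coef S i w * (W (sp_time S i.+1) w - W (sp_time S i) w).

(* I is (a version of) the Ito integral of H against W over [0, t]: the limit
   in probability of the integrals of simple predictable processes S_k with
   int_0^t (S_k - H)^2 ds -> 0 in probability. *)
Definition ito_integral F W (t : R) H I : Prop :=
  measurable_fun setT I /\
  exists S : nat -> simple_process,
    [/\ forall k, simple_predictable F t (S k),
        forall del : R, 0 < del ->
          P [set w | (del%:E <= \int[lebesgue_measure]_(s in `[0%R, t])
                         ((simple_value (S k) s w - H s w) ^+ 2)%:E)%E]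
            @[k --> \oo] --> 0%E
      & cvg_in_probability (fun k => simple_integral W (S k)) I].

End Stochastic.

Record params (R : realType) := Params {
  beta : R; gamma : R; mu : R; xi0 : R; theta : R; horizon : R
}.

Section Model.
Context {R : realType}.
Variables (p : params R) (alpha : R).
Local Notation beta := (beta p).
Local Notation gamma := (gamma p).
Local Notation mu := (mu p).
Local Notation xi0 := (xi0 p).
Local Notation theta := (theta p).
Local Notation T := (horizon p).

Definition rho : R := (1 - beta) / Num.sqrt (2 * (1 + beta ^+ 2)).
Definition nu : R :=
  Num.sqrt (theta * (1 + beta ^+ 2) / (gamma * mu * (1 + beta) ^+ 2)).
Definition V0 : R := theta * xi0.

Implicit Types (tau n k : nat) (z : R[i]).

Definition eps tau : R := gamma * tau%:R `^ (- alpha).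
Definition a_ tau : R := 1 - eps tau.
Definition mu_ tau : R := mu * tau%:R `^ (alpha - 1).
Definition N_ tau : nat := Num.truncn (tau%:R * T).
Definition t_ tau n : R := n%:R / tau%:R.
Definition c_ tau : R :=
  Num.sqrt (theta * eps tau / (2 * mu * tau%:R `^ alpha)).
Definition d_ tau : R := theta * eps tau / (2 * mu * tau%:R `^ alpha).

Definition phi n : R :=
  match n with
  | 0 => 0
  | 1 => 1 - (Gamma (1 - alpha))^-1
  | m.+1 => (Gamma (1 - alpha))^-1
              * (m%:R `^ (- alpha) - (m.+1)%:R `^ (- alpha))
  end.

Definition phit tau n : R := a_ tau * phi n.
Definition qp tau k : R := phit tau k / (1 + beta).
Definition qm tau k : R := beta * phit tau k / (1 + beta).
Definition Thetap tau z : R[i] := z * (c_ tau - d_ tau)%:C.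
Definition Thetam tau z : R[i] := - z * (c_ tau)%:C.

(* One step of the recursion; past = [:: G_(n-1); ...; G_0], so that
   past`_(k-1) = G_(n-k). *)
Definition G_step tau z n (past : seq R[i]) : R[i] :=
  cexp (Thetap tau z + \sum_(1 <= k < n.+1) (qp tau k)%:C * past`_k.-1)
  + cexp (Thetam tau z + \sum_(1 <= k < n.+1) (qm tau k)%:C * past`_k.-1)
  - 2.

Fixpoint G_past tau z n : seq R[i] :=
  if n is m.+1 then G_step tau z m (G_past tau z m) :: G_past tau z m
  else [::].

Definition G tau n z : R[i] := G_step tau z n (G_past tau z n).

Lemma nth_G_past tau z n k : (0 < k)%N -> (k <= n)%N ->
  (G_past tau z n)`_k.-1 = G tau (n - k) z.
Proof.
elim: n k => [|n IHn] [|[|k]] //= _ kn; first by rewrite subSS subn0.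
by rewrite -[k in LHS]/(k.+1.-1) IHn.
Qed.

Lemma G_rec tau n z :
  G tau n z =
    cexp (Thetap tau z + \sum_(1 <= k < n.+1) (qp tau k)%:C * G tau (n - k) z)
    + cexp (Thetam tau z
            + \sum_(1 <= k < n.+1) (qm tau k)%:C * G tau (n - k) z)
    - 2.
Proof.
rewrite {1}/G /G_step; congr (cexp (_ + _) + cexp (_ + _) - _);
  by apply: eq_big_nat => k /andP[k0 kn]; rewrite nth_G_past.
Qed.

Definition H tau n z : R[i] := (mu / (theta * eps tau))%:C * G tau n z.

Definition riccati_rhs z (x : R[i]) : R[i] :=
  (z ^+ 2 - z) / 2 + gamma%:C * ((rho * nu)%:C * z - 1) * x
  + ((gamma * nu) ^+ 2 / 2)%:C * x ^+ 2.

Definition riccati_solution z (h : R -> R[i]) : Prop :=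
  forall t, 0 <= t <= T ->
    let f s := ((t - s) `^ (alpha - 1))%:C * riccati_rhs z (h s) in
    cintegrable `[0, t] f /\
    h t = ((Gamma alpha)^-1)%:C * cintegral `[0, t] f.

Definition muhat tau n : R :=
  let S := \sum_(1 <= s < n) phit tau s in
  mu_ tau + xi0 * mu_ tau * ((1 - S) / (1 - a_ tau) - S).

Definition intensity tau n (xp xm : nat -> nat) : R :=
  muhat tau n + (1 + beta)^-1 * \sum_(1 <= s < n)
    phit tau (n - s) * ((xp s)%:R + beta * (xm s)%:R).

(* The conditional law given the (discrete) past is expressed by the product
   rule on each atom {X_s^+ = xp s, X_s^- = xm s, 1 <= s < n}. *)
Definition poisson_count_process (d : measure_display)
    (Om : measurableType d) (P : probability Om R) tau
    (Xp Xm : nat -> Om -> nat) : Prop :=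
  (forall n, (0 < n)%N ->
    measurable_fun setT (Xp n) /\ measurable_fun setT (Xm n)) /\
  forall n, (0 < n)%N -> forall (xp xm : nat -> nat) (k l : nat),
    let past := [set w | forall s, (1 <= s < n)%N ->
                           Xp s w = xp s /\ Xm s w = xm s] in
    let lam := intensity tau n xp xm in
    P (past `&` [set w | Xp n w = k /\ Xm n w = l]) =
      (P past * (poisson_pmf lam k * poisson_pmf lam l)%:E)%E.

Definition discrete_log_price (Om : Type) tau (Xp Xm : nat -> Om -> nat)
    (w : Om) : R :=
  let Np : R := \sum_(1 <= s < (N_ tau).+1) (Xp s w)%:R in
  let Nm : R := \sum_(1 <= s < (N_ tau).+1) (Xm s w)%:R in
  c_ tau * (Np - Nm) - d_ tau * Np.

Record rough_heston (d : measure_display) (Om : measurableType d)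
    (P : probability Om R) (F : R -> set (set Om))
    (WX WV V : R -> Om -> R) (PT : Om -> R) : Prop := RoughHeston {
  rh_filtration : filtration F;
  rh_WX : brownian_motion P F T WX;
  rh_WV : brownian_motion P F T WV;
  rh_cov : covariation P T WX WV rho;
  rh_adapted : adapted F T V;
  rh_continuous : continuous_paths T V;
  rh_ge0 : forall t w, 0 <= t <= T -> 0 <= V t w;
  rh_variance : forall t, 0 <= t <= T -> exists I : Om -> R,
    ito_integral P F WV t
      (fun s w => (t - s) `^ (alpha - 1) * Num.sqrt (V s w)) I /\
    {ae P, forall w, V t w =
      V0 + gamma / Gamma alpha * (\int[lebesgue_measure]_(s in `[0, t])
                                   ((t - s) `^ (alpha - 1) * (theta - V s w)))
         + gamma * nu / Gamma alpha * I w};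
  rh_price_measurable : measurable_fun setT PT;
  rh_price : exists I : Om -> R,
    ito_integral P F WX T (fun s w => Num.sqrt (V s w)) I /\
    {ae P, forall w, PT w =
      I w - 2^-1 * \int[lebesgue_measure]_(s in `[0, T]) V s w}
}.

Definition admissible_strip (d : measure_display) (Om : measurableType d)
    (P : probability Om R) (PT : Om -> R)
    (d' : nat -> measure_display) (Om' : forall tau, measurableType (d' tau))
    (P' : forall tau, probability (Om' tau) R)
    (Xp Xm : forall tau, nat -> Om' tau -> nat) (S : set R[i]) : Prop :=
  (forall z, S z ->
     exp_moment_finite P PT z /\ analytic_at (exp_moment P PT) z) /\
  \forall tau \near \oo, forall z, S z ->
     let PTt := discrete_log_price tau (Xp tau) (Xm tau) in
     exp_moment_finite (P' tau) PTt z /\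
     analytic_at (exp_moment (P' tau) PTt) z.

End Model.

(* Main.v *)
Require Import Defs.
From HB Require Import structures.
From mathcomp Require Import all_boot all_order all_algebra.
From mathcomp Require Import complex.
From mathcomp Require Import all_classical all_reals all_analysis.
From mathcomp Require Import measurable_realfun.
From mathcomp Require Import zify ring lra.

Set Implicit Arguments.
Unset Strict Implicit.
Unset Printing Implicit Defensive.

Import Order.TTheory GRing.Theory Num.Theory.
Import numFieldNormedType.Exports.
Import Normc.

Local Open Scope classical_set_scope.
Local Open Scope ring_scope.
Local Open Scope complex_scope.
Local Notation Re := complex.Re.
Local Notation Im := complex.Im.

(** Put e = tau^(- alpha) and let F be the right-hand side of the Riccati equation.
   Write P = phi * H for the convolution of the scaled sequence H with the memory
   kernel. Expanding the two exponentials to second order turns the recursion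
   into H - P = e F(P) + O(e^2) ([one_step], [H_stepE]). The limit h solves a
   Volterra equation with kernel t^(alpha - 1) / Gamma alpha. Both are put in
   the same form, through power series in X whose product is convolution.

   On the discrete side, with u = 1 / (1 - phi) the renewal sequence of the
   kernel, H = u * (H - P) = e u * F(H) + O(e): indeed H - P = O(e), and e times
   the sum of the first O(tau) values of u is bounded, as u_n <= (n + 1)^(alpha - 1).
   On the continuous side, let v be the coefficients of (1 - X)^(- alpha). Since
   F(h) is Hoelder continuous of order alpha, freezing it on each cell of the
   time grid costs O(e), and the integrals of the kernel over the cells differ
   from e v by e times a summable sequence; so h = e v * F(h) + O(e) on the grid
   ([riccati_consistent]).

   What is left is e (u - v) * F(h), and it carries the slower rate. If t denotes
   the sequence of the tail sums of phi, then 1 - phi = (1 - X) t, while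
   1 / v = (1 - X) (1 - X)^(alpha - 1). The difference b of t and the coefficients
   of (1 - X)^(alpha - 1) is nonnegative and its sum is at most 1 / Gamma (1 - alpha),
   hence at most (1 - alpha)^(1/2): this is small when alpha is close to 1,
   because of the pole of Gamma at 0. Now u - v = - b * (u * (1 - X) v). As t is
   log-convex, u is nonincreasing by Kaluza's theorem, and so is v; this bounds
   the l^1 norm of u * (1 - X) v up to time n by twice the sum of u_k v_k, thus
   by 2 (n + 1)^(2 alpha - 1) / (2 alpha - 1) ([resolvent_ex], [renewal_ex]).
   Multiplication by e, with n = O(tau), gives the order tau^(-(1 - alpha)) with
   a coefficient of order (1 - alpha)^(1/2).

   The error H - h then satisfies a linear Volterra inequality with kernel e L u,
   where L is a Lipschitz constant of F on a ball slightly larger than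
   that of h. The geometric weight (1 - sigma / tau)^n brings the mass of this
   kernel below 1/2, for a sigma that does not depend on alpha
   ([weighted_sum_le], [gronwall_bootstrap], [scheme_error]): the amplification
   is uniform in alpha and does not spoil the vanishing of the coefficient. The
   expansion being valid for large tau only, the finitely many other values of tau
   are absorbed in the constant ([H_bounded_below]). *)

(** * Real powers *)

Section RealPowers.
Context {R : realType}.
Implicit Types (a x y : R) (n m : nat).

(** Weighted AM-GM for x and 1, by comparing the logarithms of both with their
   tangents at the mean m. *)
Lemma powR_le_chord a x : 0 <= a <= 1 -> 0 < x -> x `^ a <= 1 + a * (x - 1).
Proof.
move=> /andP[a0 a1] x0; set m := 1 + _.
have m0 : 0 < m.
  have -> : m = (1 - a) + a * x by rewrite /m; ring.
  case: (ltP a 1) => [a1'|a1']; last by rewrite ltr_wpDl ?subr_ge0// mulr_gt0//; lra.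
  by rewrite ltr_pwDl ?subr_gt0// mulr_ge0// ltW.
have lnB y : 0 < y -> ln y <= y - 1.
  move=> y0; have := @le_ln1Dx R (y - 1).
  by rewrite (_ : 1 + (y - 1) = y); [apply; lra|ring].
have mE : x `^ a = expR (a * ln x) by rewrite /powR gt_eqF.
rewrite mE -[leRHS]lnK ?posrE// ler_expR.
have l1 : ln (x / m) <= x / m - 1 by apply: lnB; rewrite divr_gt0.
have l2 : ln (1 / m) <= 1 / m - 1 by apply: lnB; rewrite divr_gt0.
move: l1 l2; rewrite !ln_div ?posrE// ln1 => l1 l2.
have : a * (ln x - ln m) + (1 - a) * (0 - ln m)
       <= a * (x / m - 1) + (1 - a) * (1 / m - 1).
  by apply: lerD; rewrite ler_wpM2l// subr_ge0.
have -> : a * (x / m - 1) + (1 - a) * (1 / m - 1) = ((1 + a * (x - 1)) - m) / m.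
  by field; rewrite gt_eqF.
by rewrite -/m subrr mul0r; lra.
Qed.

Lemma powR_le_tangent a x y : 0 < a <= 1 -> 0 < x -> 0 <= y ->
  y `^ a <= x `^ a + a * x `^ (a - 1) * (y - x).
Proof.
move=> /andP[a0 a1] x0 y0.
have xE : x `^ a = x * x `^ (a - 1) by rewrite mulr_powRB1// ltW.
have p0 : 0 < x `^ (a - 1) by rewrite powR_gt0.
case: (eqVneq y 0) => [->|yn0].
  rewrite powR0 ?gt_eqF// xE sub0r.
  have -> : x * x `^ (a - 1) + a * x `^ (a - 1) * - x
    = (1 - a) * (x * x `^ (a - 1)) by ring.
  by rewrite !mulr_ge0 ?subr_ge0// ltW.
have yp : 0 < y by rewrite lt_def yn0.
have := @powR_le_chord a (y / x) _ (divr_gt0 yp x0).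
rewrite (ltW a0) a1 => /(_ isT) h.
have -> : y = (y / x) * x by rewrite divfK ?gt_eqF.
rewrite powRM ?divr_ge0 ?(ltW x0)//.
apply: le_trans (ler_wpM2r (ltW (powR_gt0 a x0)) h) _.
by rewrite xE le_eqVlt; apply/orP; left; apply/eqP; field; rewrite gt_eqF.
Qed.

Lemma powR_incr_ge a x : 0 < a <= 1 -> 1 <= x ->
  a * x `^ (a - 1) <= x `^ a - (x - 1) `^ a.
Proof.
move=> a01 x1; have := @powR_le_tangent a x (x - 1) a01.
by rewrite -subr_ge0; lra.
Qed.

Lemma powR_incr_le a x : 0 < a <= 1 -> 0 < x ->
  (x + 1) `^ a - x `^ a <= a * x `^ (a - 1).
Proof.
by move=> a01 x0; have := @powR_le_tangent a x (x + 1) a01 x0; lra.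
Qed.

Lemma sum_powR_le a n : 0 < a <= 1 ->
  \sum_(j < n) j.+1%:R `^ (a - 1) <= n%:R `^ a / a.
Proof.
move=> a01; have a0 : 0 < a by case/andP: a01.
rewrite ler_pdivlMr//; elim: n => [|n IHn].
  by rewrite big_ord0 mul0r powR_ge0.
rewrite big_ord_recr/= mulrDl.
have n1 : 1 <= n.+1%:R :> R by rewrite ler1n.
have := powR_incr_ge a01 n1.
have -> : n.+1%:R - 1 = n%:R :> R by rewrite -natr1 addrK.
by move: IHn; lra.
Qed.

Lemma ler_powRN a x y : 0 <= a -> 0 < x -> x <= y -> y `^ (- a) <= x `^ (- a).
Proof.
move=> a0 x0 xy; rewrite !powRN lef_pV2 ?posrE ?powR_gt0//; last exact: lt_le_trans xy.
by rewrite ge0_ler_powR// nnegrE ltW// (lt_le_trans x0).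
Qed.

Lemma ler_powRB1 a x y : a <= 1 -> 0 < x -> x <= y -> y `^ (a - 1) <= x `^ (a - 1).
Proof.
by move=> a1 x0 xy; rewrite -[a - 1]opprB; apply: ler_powRN => //; rewrite subr_ge0.
Qed.

(** The coefficients of the binomial series (1 - X)^(-a). *)
Definition binser a n : R := \prod_(k < n) ((k%:R + a) / k.+1%:R).

Lemma binser0 a : binser a 0 = 1. Proof. by rewrite /binser big_ord0. Qed.

Lemma binserS a n : binser a n.+1 = binser a n * ((n%:R + a) / n.+1%:R).
Proof. by rewrite /binser big_ord_recr. Qed.

Lemma binser_gt0 a n : 0 < a -> 0 < binser a n.
Proof.
move=> a0; elim: n => [|n IHn]; first by rewrite binser0.
by rewrite binserS mulr_gt0// divr_gt0// ltr_wpDl.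
Qed.

(** Consecutive coefficients have ratio 1 - (1 - a) / (n + 1), to be compared with
   ((n + 2) / (n + 1))^(a - 1) by the chord bound; likewise in [binser_ge]. *)
Lemma binser_le a n : 0 < a <= 1 -> binser a n <= n.+1%:R `^ (a - 1).
Proof.
move=> /andP[a0 a1]; elim: n => [|n IHn]; first by rewrite binser0 powR1.
rewrite binserS.
have n0 : 0 < n.+1%:R :> R by [].
have q0 : 0 <= (n%:R + a) / n.+1%:R by rewrite divr_ge0// addr_ge0// ltW.
apply: le_trans (ler_wpM2r q0 IHn) _.
set x := n.+2%:R / n.+1%:R : R.
have x0 : 0 < x by rewrite divr_gt0.
have -> : n.+2%:R = n.+1%:R * x :> R by rewrite /x mulrC divfK ?gt_eqF.
rewrite [in leRHS]powRM ?(ltW x0)// ler_wpM2l ?powR_ge0//.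
have a01 : 0 <= 1 - a <= 1 by rewrite subr_ge0 a1/= lerBlDr lerDl ltW.
have := powR_le_chord a01 x0.
rewrite -[a - 1]opprB powRN => h.
set y := x `^ _ in h *; have y0 : 0 < y by rewrite /y powR_gt0.
rewrite -[leRHS]mul1r ler_pdivlMr//.
apply: le_trans (ler_wpM2l q0 h) _.
have xE : x = 1 + n.+1%:R^-1 by rewrite /x -natr1 mulrDl mul1r divff ?gt_eqF.
have -> : (n%:R + a) / n.+1%:R = 1 - (1 - a) / n.+1%:R.
  by rewrite -[in RHS]natr1 -[in LHS]natr1; field; rewrite natr1 gt_eqF.
rewrite xE; set i := n.+1%:R^-1.
have : 0 <= (1 - a) * i * ((1 - a) * i) by rewrite -expr2 sqr_ge0.
by nra.
Qed.

Lemma binser_ge a n : 1 <= a <= 2 -> n.+1%:R `^ (a - 1) <= binser a n.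
Proof.
move=> /andP[a1 a2]; elim: n => [|n IHn]; first by rewrite binser0 powR1.
rewrite binserS.
have n0 : 0 < n.+1%:R :> R by [].
set x := n.+2%:R / n.+1%:R : R.
have x0 : 0 < x by rewrite divr_gt0.
have -> : n.+2%:R = n.+1%:R * x :> R by rewrite /x mulrC divfK ?gt_eqF.
rewrite powRM ?(ltW x0)//.
apply: ler_pM; rewrite ?powR_ge0//.
have a01 : 0 <= a - 1 <= 1 by rewrite subr_ge0 a1/=; lra.
apply: le_trans (powR_le_chord a01 x0) _.
by rewrite /x -!natr1 le_eqVlt; apply/orP; left; apply/eqP; field; rewrite natr1 gt_eqF.
Qed.

End RealPowers.

(** * Cauchy products of sequences *)

Section Conv.
Context {A : comNzRingType}.
Implicit Types (f g h : nat -> A) (n N k : nat).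

Definition cauchyM f g n : A := \sum_(k < n.+1) f k * g (n - k)%N.
Definition unit_seq n : A := (n == 0)%:R.
Definition ones n : A := 1.
Definition diff_seq n : A := (n == 0)%:R - (n == 1)%:R.

(* Products are compared with those of truncated polynomials, whose ring laws
   they inherit. *)
Let trunc N f : {poly A} := \poly_(i < N) f i.

Let cauchyME N f g n : (n < N)%N -> cauchyM f g n = (trunc N f * trunc N g)`_n.
Proof.
move=> nN; rewrite coefM; apply: eq_bigr => -[k kn] _ /=.
rewrite !coef_poly (@leq_ltn_trans n k N kn nN).
by rewrite (leq_ltn_trans (leq_subr _ _) nN).
Qed.

Lemma cauchyMC f g : cauchyM f g = cauchyM g f.
Proof.
by apply/funext => n; rewrite !(@cauchyME n.+1)// mulrC.
Qed.

Lemma cauchyMA f g h : cauchyM f (cauchyM g h) = cauchyM (cauchyM f g) h.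
Proof.
apply/funext => n.
have tE N p q k : (k < N)%N -> (trunc N (cauchyM p q))`_k = (trunc N p * trunc N q)`_k.
  by move=> kN; rewrite coef_poly kN (@cauchyME N).
rewrite !(@cauchyME n.+1)//.
transitivity (trunc n.+1 f * (trunc n.+1 g * trunc n.+1 h))`_n.
  rewrite !coefM; apply: eq_bigr => -[k kn] _; congr (_ * _).
  by rewrite tE//= ltnS leq_subr.
by rewrite mulrA !coefM; apply: eq_bigr => -[k kn] _; rewrite tE.
Qed.

Lemma cauchyMCA f g h : cauchyM f (cauchyM g h) = cauchyM g (cauchyM f h).
Proof. by rewrite !cauchyMA (cauchyMC f). Qed.

Lemma cauchyM1l f : cauchyM unit_seq f = f.
Proof.
apply/funext => n; rewrite /cauchyM big_ord_recl subn0 mul1r big1 ?addr0// => k _.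
by rewrite /unit_seq mul0r.
Qed.

Lemma cauchyM1r f : cauchyM f unit_seq = f.
Proof. by rewrite cauchyMC cauchyM1l. Qed.

Lemma cauchyMBl f g h : cauchyM (f \- g) h = cauchyM f h \- cauchyM g h.
Proof.
by apply/funext => n; rewrite /= /cauchyM -sumrB; apply: eq_bigr => k _; rewrite mulrBl.
Qed.

Lemma cauchyM_ones f n : cauchyM f ones n = \sum_(k < n.+1) f k.
Proof. by apply: eq_bigr => k _; rewrite mulr1. Qed.

Lemma cauchyM_recr f g n :
  cauchyM f g n.+1 = \sum_(k < n.+1) f k * g (n.+1 - k)%N + f n.+1 * g 0.
Proof. by rewrite /cauchyM big_ord_recr/= subnn. Qed.

Lemma cauchyM_diff0 f : cauchyM diff_seq f 0 = f 0.
Proof. by rewrite /cauchyM big_ord1 /diff_seq subr0 mul1r. Qed.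

Lemma cauchyM_diffS f n : cauchyM diff_seq f n.+1 = f n.+1 - f n.
Proof.
rewrite /cauchyM !big_ord_recl/= big1 => [|k _]; last by rewrite /diff_seq subr0 mul0r.
by rewrite /bump/= subn0 subSS subn0 /diff_seq/= subr0 sub0r addr0 mul1r mulN1r.
Qed.

Lemma cauchyM_diff_ones : cauchyM diff_seq ones = unit_seq.
Proof.
apply/funext => -[|n]; first by rewrite cauchyM_diff0.
by rewrite cauchyM_diffS subrr.
Qed.

Lemma cauchyM_diffK f : cauchyM (cauchyM diff_seq f) ones = f.
Proof. by rewrite -cauchyMA (cauchyMC f) cauchyMA cauchyM_diff_ones cauchyM1l. Qed.

Let inv_past f : nat -> seq A := fix inv_past n :=
  if n is m.+1 then
    ((m == 0)%:R - \sum_(1 <= k < m.+1) f k * (inv_past m)`_k.-1) :: inv_past m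
  else [::].

(** With constant term 1, each coefficient of the inverse is determined by the
   previous ones, which [inv_past] keeps in a list. *)
Lemma cauchyM_inv f : f 0 = 1 -> exists g, cauchyM f g = unit_seq.
Proof.
move=> f0; pose g n := head 0 (inv_past f n.+1).
have nthg n k : (0 < k)%N -> (k <= n)%N -> (inv_past f n)`_k.-1 = g (n - k)%N.
  elim: n k => [|n IHn] [|[|k]] //= _ kn; first by rewrite subSS subn0.
  by rewrite -[k in LHS]/(k.+1.-1) IHn.
exists g; apply/funext => n; rewrite /cauchyM big_ord_recl f0 mul1r subn0.
rewrite {1}/g/= big_add1/= big_mkord.
rewrite (eq_bigr (fun i : 'I_n => f i.+1 * g (n - i.+1)%N)) ?subrK// => i _.
by rewrite -(nthg n i.+1).
Qed.

End Conv.

Section Binser.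
Context {R : realType}.

Lemma binser1 : binser 1 = ones :> (nat -> R).
Proof.
apply/funext; elim=> [|n IHn]; first by rewrite binser0.
by rewrite binserS IHn natr1 divff ?pnatr_eq0// mulr1.
Qed.

(** The Vandermonde identity, (1 - X)^(-a) (1 - X)^(-b) = (1 - X)^(-(a + b)): both
   sides satisfy (n + 1) c_(n + 1) = (n + a + b) c_n. *)
Lemma cauchyM_binser (a b : R) : cauchyM (binser a) (binser b) = binser (a + b).
Proof.
have rec x n : n.+1%:R * binser x n.+1 = (n%:R + x) * binser x n :> R.
  by rewrite binserS mulrCA [n.+1%:R * _]mulrC divfK ?pnatr_eq0// mulrC.
apply/funext; elim=> [|n IHn]; first by rewrite /cauchyM big_ord1 !binser0 mulr1.
have n0 : n.+1%:R != 0 :> R by [].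
apply: (mulfI n0); rewrite rec -IHn /cauchyM mulr_sumr.
transitivity (\sum_(k < n.+2) (k%:R * binser a k * binser b (n.+1 - k)%N
               + binser a k * ((n.+1 - k)%N%:R * binser b (n.+1 - k)%N))).
  apply: eq_bigr => -[k /= kn] _; rewrite ltnS in kn.
  by rewrite natrB//; ring.
rewrite big_split/= big_ord_recl/= !mul0r add0r [X in _ + X]big_ord_recr/= subnn.
rewrite mul0r mulr0 addr0 -big_split/= mulr_sumr; apply: eq_bigr => -[k /= kn] _.
rewrite ltnS in kn; rewrite /bump/= add1n subSS subSn// !rec natrB//.
ring.
Qed.

End Binser.

(** * Positivity and monotonicity of reciprocal series *)

Section Estimates.
Context {R : realType}.
Implicit Types (f g t u v : nat -> R).

Lemma sum_cauchyM f g n :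
  \sum_(k < n.+1) cauchyM f g k = \sum_(k < n.+1) f k * \sum_(j < (n - k).+1) g j.
Proof.
rewrite -cauchyM_ones -cauchyMA {1}/cauchyM; apply: eq_bigr => k _.
by rewrite cauchyM_ones.
Qed.

Lemma sum_norm_cauchyM f g n :
  \sum_(k < n.+1) `|cauchyM f g k|
    <= (\sum_(k < n.+1) `|f k|) * (\sum_(k < n.+1) `|g k|).
Proof.
apply: (@le_trans _ _ (\sum_(k < n.+1) cauchyM (fun i => `|f i|) (fun i => `|g i|) k)).
  apply: ler_sum => k _; apply: le_trans (ler_norm_sum _ _ _) _.
  by apply: ler_sum => j _; rewrite normrM.
rewrite sum_cauchyM mulr_suml; apply: ler_sum => k _.
rewrite ler_wpM2l// -!(big_mkord xpredT (fun j => `|g j|)).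
rewrite [leRHS](@big_cat_nat _ _ _ (n - k).+1)//= ?ltnS ?leq_subr//.
by rewrite lerDl sumr_ge0.
Qed.

(** Kaluza's theorem: log-convexity makes the ratios t (n + 1) / t n
   nondecreasing, so that, subtracting from the equation for the (n + 1)-st
   coefficient of the reciprocal the multiple of the n-th one that cancels
   the leading term, all the remaining terms have the same sign. *)
Lemma kaluza t w : t 0 = 1 -> (forall n, 0 < t n) ->
  (forall n, t n.+1 ^+ 2 <= t n * t n.+2) ->
  cauchyM w t = unit_seq -> forall n, w n.+1 <= 0.
Proof.
move=> t0 tp tlc wt.
have w0 : w 0 = 1.
  have := congr1 (@^~ 0) wt; rewrite /cauchyM big_ord1 t0 mulr1 => ->.
  by rewrite /unit_seq eqxx.
have ratio m n : (m <= n)%N -> t m.+1 * t n <= t n.+1 * t m.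
  elim: n => [|n IHn]; first by rewrite leqn0 => /eqP ->.
  rewrite leq_eqVlt => /orP[/eqP ->//|]; rewrite ltnS => /IHn h.
  rewrite -(ler_pM2r (tp n)) mulrAC -(mulrA (t n.+2)).
  have := ler_wpM2r (ltW (tp n.+1)) h.
  have := ler_wpM2l (ltW (tp m)) (tlc n).
  rewrite expr2; nra.
elim/ltn_ind => n IHn.
case: n IHn => [_|n IHn].
  have := congr1 (@^~ 1) wt; rewrite /cauchyM big_ord_recl big_ord1 w0 /unit_seq/=.
  rewrite /bump/= subnn subn0 t0 mul1r mulr1 => /eqP.
  by rewrite addr_eq0 => /eqP h; have := tp 1; rewrite h; lra.
have e1 : w n.+2 + \sum_(k < n.+2) w k * t (n.+2 - k)%N = 0.
  have := congr1 (@^~ n.+2) wt; rewrite /cauchyM big_ord_recr/= subnn t0 mulr1.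
  by rewrite addrC.
have e2 : \sum_(k < n.+2) w k * t (n.+1 - k)%N = 0.
  by have := congr1 (@^~ n.+1) wt.
set r := t n.+2 / t n.+1.
have -> : w n.+2 = - \sum_(k < n.+2) w k * (t (n.+2 - k)%N - r * t (n.+1 - k)%N).
  have -> : \sum_(k < n.+2) w k * (t (n.+2 - k)%N - r * t (n.+1 - k)%N)
      = \sum_(k < n.+2) w k * t (n.+2 - k)%N - r * \sum_(k < n.+2) w k * t (n.+1 - k)%N.
    by rewrite mulr_sumr -sumrB; apply: eq_bigr => k _; ring.
  by rewrite e2; move: e1; lra.
rewrite oppr_le0 big_ord_recl !subn0 /r divfK ?gt_eqF// subrr mulr0 add0r.
apply: sumr_ge0 => -[k /= kn] _; rewrite /bump/= add1n.
rewrite mulr_le0//; first exact: IHn.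
rewrite subr_le0 subSS subSn// -/r /r mulrAC ler_pdivlMr//.
by rewrite subSS; apply: ratio; exact: leqW (leq_subr _ _).
Qed.

(** Monotonicity bounds each coefficient c_k of u * (1 - X) v by u_k v_k, so that
   |c_k| <= 2 u_k v_k - c_k; and the sum of the c_k is a coefficient of u * v,
   hence nonnegative. *)
Lemma sum_norm_cauchyM_diff u v n :
  (forall k, 0 <= u k) -> (forall k, 0 <= v k) ->
  (forall k, u k.+1 <= u k) -> (forall k, v k.+1 <= v k) ->
  \sum_(k < n.+1) `|cauchyM u (cauchyM diff_seq v) k| <= 2 * \sum_(k < n.+1) u k * v k.
Proof.
move=> u0 v0 ud vd; set c := cauchyM u _.
have cE k : c k = u k * v k
    + \sum_(j < k.+1) cauchyM diff_seq v j * (u (k - j)%N - u k).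
  have -> : u k * v k = \sum_(j < k.+1) cauchyM diff_seq v j * u k.
    by rewrite -mulr_suml -cauchyM_ones cauchyM_diffK mulrC.
  by rewrite /c cauchyMC -big_split/=; apply: eq_bigr => j _; ring.
have cle k : c k <= u k * v k.
  rewrite cE gerDl; apply: sumr_le0 => -[[|j] /= jk] _.
    by rewrite subn0 subrr mulr0.
  rewrite cauchyM_diffS mulr_le0_ge0 ?subr_le0// subr_ge0.
  have udn x y : (x <= y)%N -> u y <= u x.
    elim: y => [|y IHy]; first by rewrite leqn0 => /eqP ->.
    by rewrite leq_eqVlt => /predU1P[->//|]; rewrite ltnS => /IHy; apply: le_trans.
  by apply: udn; rewrite leq_subr.
have cn k : `|c k| <= 2 * (u k * v k) - c k.
  by rewrite ler_norml; have := cle k; have := mulr_ge0 (u0 k) (v0 k); lra.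
apply: (@le_trans _ _ (\sum_(k < n.+1) (2 * (u k * v k) - c k))).
  by apply: ler_sum => k _; exact: cn.
rewrite sumrB -mulr_sumr gerBl.
have -> : \sum_(k < n.+1) c k = cauchyM u v n.
  by rewrite -cauchyM_ones /c -cauchyMA cauchyM_diffK.
by apply: sumr_ge0 => k _; rewrite mulr_ge0.
Qed.

(** The reciprocal of (1 - X) t is compared with (1 - X)^(-a), the reciprocal of
   (1 - X) (1 - X)^(a - 1). With b the difference of t and (1 - X)^(a - 1), their
   difference is - b * (u * (1 - X) v), where v denotes (1 - X)^(-a). By Kaluza's
   theorem u is nonincreasing, hence [sum_norm_cauchyM_diff] applies to u and v. *)
Lemma resolvent_ex (a del : R) t : 2^-1 < a < 1 ->
  t 0 = 1 -> (forall n, 0 < t n) -> (forall n, t n.+1 <= t n) ->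
  (forall n, t n.+1 ^+ 2 <= t n * t n.+2) ->
  (forall n, binser (1 - a) n <= t n) ->
  (forall n, \sum_(k < n.+1) (t k - binser (1 - a) k) <= del) ->
  exists u : nat -> R, [/\ cauchyM u t = ones, forall n, 0 <= u n,
    forall n, u n <= n.+1%:R `^ (a - 1)
  & forall n, \sum_(k < n.+1) `|u k - binser a k|
                <= 2 * del / (2 * a - 1) * n.+1%:R `^ (2 * a - 1)].
Proof.
move=> /andP[a12 a1] t0 tp td tlc ts tdel.
have a0 : 0 < a by lra.
have [w tw] := cauchyM_inv t0; have wt : cauchyM w t = unit_seq by rewrite cauchyMC.
have wle := kaluza t0 tp tlc wt.
pose u := cauchyM w ones; exists u.
have ut : cauchyM u t = ones by rewrite /u -cauchyMA (cauchyMC ones) cauchyMA wt cauchyM1l.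
have ud n : u n.+1 <= u n.
  by rewrite /u !cauchyM_ones [leLHS]big_ord_recr/= gerDl.
have du : cauchyM u (cauchyM diff_seq t) = unit_seq.
  by rewrite cauchyMCA ut cauchyM_diff_ones.
have u0 n : 0 <= u n.
  elim/ltn_ind: n => -[|n] IHn.
    have := congr1 (@^~ 0) ut; rewrite /cauchyM big_ord1 t0 mulr1 => ->.
    exact: ler01.
  have := congr1 (@^~ n.+1) du.
  rewrite cauchyM_recr cauchyM_diff0 t0 mulr1 /unit_seq/= => /eqP.
  rewrite addrC addr_eq0 => /eqP ->; rewrite oppr_ge0; apply: sumr_le0 => -[k /= kn] _.
  by rewrite mulr_ge0_le0 ?IHn// subSn// cauchyM_diffS subr_le0.
have udn x y : (x <= y)%N -> u y <= u x.
  elim: y => [|y IHy]; first by rewrite leqn0 => /eqP ->.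
  by rewrite leq_eqVlt => /predU1P[->//|]; rewrite ltnS => /IHy; apply: le_trans.
(* In the convolution identity u * t = 1 the smallest value of u up to n is the
   last one, and the sum of t up to n is at least (n + 1)^(1 - a). *)
have ule n : u n <= n.+1%:R `^ (a - 1).
  rewrite -[a - 1]opprB powRN -[leRHS]mul1r ler_pdivlMr ?powR_gt0//.
  apply: (@le_trans _ _ (cauchyM t u n)); last by rewrite cauchyMC ut.
  apply: (@le_trans _ _ (u n * binser (1 - a + 1) n)).
    rewrite ler_wpM2l// (le_trans _ (@binser_ge _ (1 - a + 1) n _))//; last by lra.
    by rewrite addrK.
  have <- : \sum_(k < n.+1) binser (1 - a) k = binser (1 - a + 1) n.
    by rewrite -cauchyM_ones -binser1 (cauchyM_binser (1 - a)).
  rewrite mulr_sumr; apply: ler_sum => k _; rewrite mulrC ler_pM//.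
    by rewrite ltW// binser_gt0// subr_gt0.
  by apply: udn; rewrite leq_subr.
split=> // n; pose v := binser a.
have vd k : v k.+1 <= v k.
  rewrite /v binserS ler_piMr ?(ltW (binser_gt0 _ _))// ler_pdivrMr// mul1r -natr1.
  by rewrite lerD2l ltW.
have vs : cauchyM v (binser (1 - a)) = ones.
  by rewrite cauchyM_binser (_ : a + (1 - a) = 1) ?binser1//; ring.
pose b : nat -> R := fun k => t k - binser (1 - a) k.
have uvE : u \- v = cauchyM (fun k => - b k) (cauchyM u (cauchyM diff_seq v)).
  have bE : (fun k => - b k) = binser (1 - a) \- t.
    by apply/funext => k; rewrite /b/= opprB.
  have dvs : cauchyM (binser (1 - a)) (cauchyM diff_seq v) = unit_seq.
    by rewrite cauchyMCA (cauchyMC _ v) vs cauchyM_diff_ones.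
  rewrite bE cauchyMBl (cauchyMCA _ u) dvs cauchyM1r (cauchyMA t) (cauchyMC t) ut.
  by rewrite (cauchyMC ones) cauchyM_diffK.
under eq_bigr => k _ do rewrite (_ : u k - binser a k = (u \- v) k)// uvE.
apply: le_trans (sum_norm_cauchyM _ _ _) _.
have b0 k : `|- b k| = b k by rewrite normrN ger0_norm// subr_ge0.
under eq_bigr do rewrite b0.
have v0 k : 0 <= v k by rewrite ltW// binser_gt0.
have del0 : 0 <= del.
  by apply: le_trans (tdel 0); apply: sumr_ge0 => k _; rewrite subr_ge0.
have h2 : \sum_(k < n.+1) u k * v k <= n.+1%:R `^ (2 * a - 1) / (2 * a - 1).
  have a2 : 0 < 2 * a - 1 <= 1 by lra.
  apply: le_trans (sum_powR_le n.+1 a2); apply: ler_sum => k _.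
  have -> : 2 * a - 1 - 1 = (a - 1) + (a - 1) by ring.
  rewrite powRD ?pnatr_eq0 ?implybT//.
  by rewrite ler_pM// binser_le// a0 ltW.
apply: le_trans (ler_pM _ _ (tdel n) (sum_norm_cauchyM_diff n u0 v0 ud vd)) _.
- by apply: sumr_ge0 => k _; rewrite subr_ge0.
- exact: sumr_ge0.
apply: le_trans (ler_wpM2l del0 (ler_wpM2l _ h2)) _ => //.
by rewrite le_eqVlt; apply/orP; left; apply/eqP; ring.
Qed.

End Estimates.

(** * Improper integrals *)

Section Integrability.
Context {R : realType}.
Notation mu := (@lebesgue_measure R).
Implicit Types (D E : set R) (f g : R -> R).

Lemma integrable_subset D E f : measurable D -> measurable E -> D `<=` E ->
  mu.-integrable E (EFin \o f) -> mu.-integrable D (EFin \o f).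
Proof. by move=> mD mE DE; exact: integrableS. Qed.

Lemma integrable_scale D f c : measurable D ->
  mu.-integrable D (EFin \o f) -> mu.-integrable D (EFin \o (fun x => c * f x)).
Proof. move=> mD fi.
rewrite (_ : EFin \o _ = (fun x => c%:E * (EFin \o f) x)%E); last exact/funext.
exact: (@integrableZl _ _ _ mu _ mD c _ fi). Qed.

Lemma integrable_le D f g : measurable D -> measurable_fun D f ->
  (forall x, D x -> `|f x| <= g x) ->
  mu.-integrable D (EFin \o g) -> mu.-integrable D (EFin \o f).
Proof.
move=> mD mf fg gi; apply: (@le_integrable _ _ _ mu _ mD _ _ _ _ gi); first exact/measurable_EFinP.
by move=> x /fg h; rewrite /= lee_fin (le_trans h)// ler_norm.
Qed.

Lemma integrable_ge0 D f (c : R) : measurable_fun D f ->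
  (forall x, D x -> 0 <= f x) -> (\int[mu]_(x in D) (f x)%:E = c%:E)%E ->
  mu.-integrable D (EFin \o f).
Proof.
move=> mf f0 fc; apply/integrableP; split; first exact/measurable_EFinP.
under eq_integral => x /set_mem Dx do rewrite /= ger0_norm ?f0//.
by rewrite fc ltry.
Qed.

Lemma integrable_setU D E f : measurable D -> measurable E -> [disjoint D & E] ->
  mu.-integrable D (EFin \o f) -> mu.-integrable E (EFin \o f) ->
  mu.-integrable (D `|` E) (EFin \o f).
Proof.
move=> mD mE DE /integrableP[mfD iD] /integrableP[mfE iE].
have mf : measurable_fun (D `|` E) (EFin \o f) by apply/measurable_funU.
apply/integrableP; split => //.
rewrite ge0_integral_setU//=; first exact: lte_add_pinfty.
apply/measurable_EFinP; apply: measurableT_comp => //.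
exact/measurable_EFinP.
Qed.

Lemma integrable_sub D f g : measurable D ->
  mu.-integrable D (EFin \o f) -> mu.-integrable D (EFin \o g) ->
  mu.-integrable D (EFin \o (fun x => f x - g x)).
Proof. by move=> mD fi gi; exact: (@integrableB _ _ _ mu _ mD _ _ fi gi). Qed.

Lemma eq_integrable_in D f g : measurable D -> (forall x, D x -> f x = g x) ->
  mu.-integrable D (EFin \o f) -> mu.-integrable D (EFin \o g).
Proof.
by move=> mD fg; apply: eq_integrable => // x /set_mem Dx; rewrite /= fg.
Qed.

End Integrability.

Section ImproperFTC.
Context {R : realType}.
Notation mu := (@lebesgue_measure R).
Implicit Types (f F : R -> R) (a b : R).

(** The formula holds on compact subintervals; the sign of f allows the passage to
   the limit by monotone convergence, and then shows that f is integrable. *)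
Lemma ge0_improper_FTC2 f F a b A B : a < b ->
  (forall x, a < x < b -> 0 <= f x) ->
  (forall x, a < x < b -> {for x, continuous f}) ->
  (forall x, a < x < b -> is_derive x 1 F (f x)) ->
  F x @[x --> a^'+] --> A -> F x @[x --> b^'-] --> B ->
  (\int[mu]_(x in `]a, b[) (f x)%:E = (B - A)%:E)%E.
Proof.
move=> ab f0 fc FD FA FB.
pose h n : R := (b - a) * (3^-1 * harmonic n).
have ba : 0 < b - a by rewrite subr_gt0.
have h0 n : 0 < h n by rewrite mulr_gt0// mulr_gt0//= invr_gt0 ltr0n.
have hle n m : (n <= m)%N -> h m <= h n.
  move=> nm; rewrite /h ler_pM2l// ler_pM2l ?invr_gt0//.
  by rewrite /harmonic/= lef_pV2 ?posrE ?ltr0n// ler_nat.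
have h3 n : h n <= (b - a) / 3.
  by apply: le_trans (hle 0 n _) _ => //; rewrite /h/= invr1 mulr1.
have hcvg : h n @[n --> \oo] --> (0 : R).
  rewrite -[0](mulr0 (b - a)) -[X in _ * X](mulr0 3^-1).
  by apply: cvgMr; apply: cvgMr; exact: cvg_harmonic.
pose D n := `[a + h n, b - h n]%classic.
have Dsub n x : D n x -> a < x < b.
  by rewrite /D/= in_itv/= => /andP[h1 h2]; have := h0 n; lra.
have Dlt n : a + h n < b - h n by have := h3 n; lra.
have DE : \bigcup_n D n = `]a, b[%classic.
  apply/seteqP; split=> x.
    by move=> [n _ /Dsub]; rewrite /= in_itv/=.
  rewrite /= in_itv/= => /andP[ax xb].
  have : \forall n \near \oo, h n < Num.min (x - a) (b - x).
    by apply: (cvgr_lt (0 : R)) => //; rewrite lt_min !subr_gt0 ax xb.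
  case=> N _ /(_ N (leqnn N))/=; rewrite lt_min => /andP[h1 h2].
  by exists N => //; rewrite /D/= in_itv/=; lra.
have cF x : a < x < b -> {for x, continuous F}.
  move=> xab; apply/differentiable_continuous/derivable1_diffP.
  by have [] := FD _ xab.
have cD n : {within D n, continuous f}.
  by apply: continuous_in_subspaceT => x /set_mem /Dsub; exact: fc.
have ID n : (\int[mu]_(x in D n) (f x)%:E = (F (b - h n) - F (a + h n))%:E)%E.
  rewrite (continuous_FTC2 (Dlt n) (cD n) _ _ : _ = (F (b - h n))%:E - (F (a + h n))%:E)%E//.
  - split.
    + move=> x; rewrite in_itv/= => xi.
      suff /FD[] : a < x < b by [].
      by have := h0 n; lra.
    + by apply/cvg_at_right_filter/cF; have := h0 n; have := Dlt n; lra.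
    + by apply/cvg_at_left_filter/cF; have := h0 n; have := Dlt n; lra.
  - move=> x; rewrite in_itv/= => xi; rewrite derive1E.
    suff /FD[_ ->//] : a < x < b by [].
    by have := h0 n; lra.
have mf : measurable_fun `]a, b[ f.
  apply: open_continuous_measurable_fun => // x; rewrite inE/= in_itv/=.
  exact: fc.
rewrite -DE; apply: (@cvg_unique _ _ (\int[mu]_(x in D n) (f x)%:E @[n --> \oo])%E) => //.
  apply: ge0_nondecreasing_set_cvg_integral.
  - move=> n m nm; apply/subsetPset => x; rewrite /D/= !in_itv/=.
    by have := hle _ _ nm; lra.
  - by move=> n; exact: measurable_itv.
  - by move=> n; apply/measurable_EFinP; apply: measurable_funS mf => //; rewrite -DE; exact: bigcup_sup.
  - by move=> n x /Dsub xab; rewrite lee_fin f0.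
rewrite /mkset (funext ID); apply: cvg_EFin; first exact: nearW.
rewrite /=.
apply: cvgB.
- move/cvg_at_leftP : FB; apply; split => [n|]; first by have := h0 n; lra.
  by rewrite -[X in _ --> X]subr0; apply: cvgB => //; exact: cvg_cst.
- move/cvg_at_rightP : FA; apply; split => [n|]; first by have := h0 n; lra.
  by rewrite -[X in _ --> X]addr0; apply: cvgD => //; exact: cvg_cst.
Qed.

Lemma continuous_powR (a x : R) : 0 < x -> {for x, continuous (@powR R ^~ a)}.
Proof.
move=> x0; apply/differentiable_continuous/derivable1_diffP.
by apply: derivable_powR; rewrite in_itv/= andbT.
Qed.

Lemma continuous_powR_subl (a t x : R) : x < t ->
  {for x, continuous (fun s => (t - s) `^ a)}.
Proof.
move=> xt; apply: (@continuous_comp _ _ _ (fun s => t - s) (@powR R ^~ a)).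
  by apply: cvgB; [exact: cvg_cst|exact: cvg_id].
by apply: continuous_powR; rewrite subr_gt0.
Qed.

Lemma powR_subl_cvg_at_left (a t x : R) : 0 < a -> x <= t ->
  (t - s) `^ a @[s --> x^'-] --> (t - x) `^ a.
Proof.
move=> a0; rewrite le_eqVlt => /predU1P[->|xt]; last first.
  by apply: cvg_at_left_filter; exact: continuous_powR_subl.
apply/cvg_at_leftP => u [ut ucvg]; rewrite subrr powR0 ?gt_eqF//.
have /cvg_at_rightP := powR_cvg0 a0; apply; split.
  by move=> n; rewrite subr_gt0.
by rewrite -(subrr t); apply: cvgB => //; exact: cvg_cst.
Qed.

(** The case y = t is the one that matters: there the integrand is unbounded, but
   the primitive - (t - s)^a / a is continuous up to s = t. *)
Lemma integral_powR (a t x y : R) : 0 < a -> x < y -> y <= t ->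
  (\int[mu]_(s in `]x, y[) ((t - s) `^ (a - 1))%:E
     = (((t - x) `^ a - (t - y) `^ a) / a)%:E)%E.
Proof.
move=> a0 xy yt.
pose F s : R := - (a^-1 * (t - s) `^ a).
have FD s : x < s < y -> is_derive s 1 F ((t - s) `^ (a - 1)).
  move=> /andP[xs sy]; have ts : 0 < t - s by lra.
  have h1 : is_derive s 1 (fun s : R => t - s) (-1).
    have -> : (-1 : R) = 0 - 1 by rewrite sub0r.
    by apply: is_deriveB.
  have h2 := @is_derive1_comp R (@powR R ^~ a) (fun s => t - s) s _ _
    (is_derive1_powR a ts) h1.
  have h3 := is_deriveZ (- a^-1) h2.
  have FE : F = - a^-1 \*: (@powR R ^~ a \o (fun s => t - s)).
    by apply/funext => u; rewrite /F/= scaleNr.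
  rewrite FE; apply: is_derive_eq h3 _.
  by rewrite mulrN1 scaleNr scalerN opprK /= /GRing.scale/= mulrA mulVf ?mul1r// gt_eqF.
rewrite (@ge0_improper_FTC2 _ F x y (F x) (F y))//.
- by congr EFin; rewrite /F; field; rewrite gt_eqF.
- by move=> s _; rewrite powR_ge0.
- by move=> s /andP[_ sy]; apply: continuous_powR_subl; exact: lt_le_trans sy yt.
- apply: cvg_at_right_filter; apply: cvgN; apply: cvgMr.
  by apply: continuous_powR_subl; exact: lt_le_trans yt.
- by apply: cvgN; apply: cvgMr; exact: powR_subl_cvg_at_left.
Qed.

End ImproperFTC.

(** * The Gamma function *)

Section GammaFunction.
Context {R : realType}.
Notation mu := (@lebesgue_measure R).
Implicit Types (a s t x : R).

Let g a t : R := t `^ (a - 1) * expR (- t).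

Let mg a (D : set R) : measurable D -> measurable_fun D (g a).
Proof.
move=> mD; apply: measurable_funS (_ : measurable_fun setT _) => //.
apply: measurable_funM; first exact: measurable_powR.
by apply: measurableT_comp => //; exact: measurable_oppr.
Qed.

Let g_ge0 a t : 0 <= g a t.
Proof. by rewrite mulr_ge0 ?powR_ge0 ?expR_ge0. Qed.

Lemma integral_powR0 a x : 0 < a -> 0 < x ->
  (\int[mu]_(s in `]0%R, x[) (s `^ (a - 1))%:E = (x `^ a / a)%:E)%E.
Proof.
move=> a0 x0.
have D s : 0 < s < x -> is_derive s 1 (fun s => a^-1 * s `^ a) (s `^ (a - 1)).
  move=> /andP[s0 _]; have h := is_deriveZ a^-1 (is_derive1_powR a s0).
  by apply: is_derive_eq h _; rewrite /GRing.scale/= mulrA mulVf ?mul1r// gt_eqF.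
rewrite (ge0_improper_FTC2 (A := 0) (B := a^-1 * x `^ a) x0 _ _ D)//.
- by rewrite subr0 mulrC.
- by move=> s _; rewrite powR_ge0.
- by move=> s /andP[s0 _]; exact: continuous_powR.
- have : a^-1 * s `^ a @[s --> 0^'+] --> a^-1 * 0 by apply: cvgMr; exact: powR_cvg0.
  by rewrite mulr0.
- by apply: cvg_at_left_filter; apply: cvgMr; exact: continuous_powR.
Qed.

(* The factor 2 leaves half of the exponential decay for integrability. *)
Let powR_expR_le a t : 0 < a -> 0 <= t ->
  t `^ a * expR (- t) <= (2 * a) `^ a * expR (- (t / 2)).
Proof.
move=> a0 t0; have a2 : 0 < 2 * a by rewrite mulr_gt0.
have h : t `^ a <= (2 * a) `^ a * expR (t / 2).
  have -> : t = (2 * a) * (t / (2 * a)) by field; rewrite gt_eqF.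
  rewrite powRM ?(ltW a2) ?divr_ge0 ?(ltW a2)// ler_wpM2l ?powR_ge0//.
  have -> : expR (2 * a * (t / (2 * a)) / 2) = expR (t / (2 * a)) `^ a.
    by rewrite -expRM; congr expR; field; rewrite gt_eqF.
  rewrite ge0_ler_powR ?(ltW a0) ?nnegrE ?divr_ge0 ?(ltW a2) ?expR_ge0//.
  by rewrite (le_trans _ (expR_ge1Dx _))// lerDr.
apply: le_trans (ler_wpM2r (expR_ge0 _) h) _.
by rewrite -mulrA -expRD (_ : t / 2 - t = - (t / 2))//; field.
Qed.

Let integrable_expR_half : mu.-integrable `[0%R, +oo[ (EFin \o fun t => expR (- (t / 2))).
Proof.
have r0 : 0 < 2^-1 :> R by [].
pose e := exponential_pdf (2^-1 : R).
have ie : mu.-integrable setT (EFin \o e).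
  apply: (@integrable_ge0 _ _ _ 1); first exact: measurable_exponential_pdf.
    by move=> t _; exact: exponential_pdf_ge0.
  exact: integral_exponential_pdf.
have h : mu.-integrable `[0%R, +oo[ (EFin \o (fun t => 2 * e t)).
  by apply: integrable_scale => //; apply: integrable_subset ie.
apply: eq_integrable h => // t; rewrite inE/= in_itv/= andbT => t0.
rewrite /e exponential_pdfE// mulrA divff// mul1r; congr (EFin (expR _)).
by rewrite mulNr mulrC.
Qed.

Lemma integrable_Gamma a : 0 < a -> mu.-integrable `]0%R, +oo[ (EFin \o g a).
Proof.
move=> a0.
rewrite (@itv_bndbnd_setU _ _ _ (BLeft 1)) ?bnd_simp//.
apply: integrable_setU => //.
- apply/disj_setPS => t /=; rewrite !in_itv/=.
  by move=> [/andP[_ h1] /andP[h2 _]]; move: h1; rewrite ltNge h2.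
- apply: (@integrable_le _ _ _ (fun s => s `^ (a - 1))) => //; first exact: mg.
    move=> t /=; rewrite in_itv/= => /andP[t0 _].
    rewrite ger0_norm ?g_ge0// /g ler_piMr ?powR_ge0//.
    by rewrite -expR0 ler_expR oppr_le0 ltW.
  apply: integrable_ge0 (integral_powR0 a0 ltr01) => [|t _]; last exact: powR_ge0.
  by apply: measurable_funS (_ : measurable_fun setT _) => //; exact: measurable_powR.
- apply: (@integrable_le _ _ _ (fun t => (2 * a) `^ a * expR (- (t / 2)))) => //.
  + exact: mg.
  + move=> t /=; rewrite in_itv/= andbT => t1; have t0 : 0 < t by rewrite (lt_le_trans _ t1).
    rewrite ger0_norm ?g_ge0//.
    apply: le_trans (powR_expR_le a0 (ltW t0)).
    by rewrite /g ler_wpM2r ?expR_ge0// ler_powR// gerBl.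
  + apply: integrable_scale => //; apply: integrable_subset integrable_expR_half => //.
    by apply: subset_itvr; rewrite bnd_simp.
Qed.

Lemma GammaE a : 0 < a -> Gamma a = \int[mu]_(t in `]0%R, +oo[) g a t.
Proof.
by move=> a0; rewrite /Gamma -Rintegral_itv_obnd_cbnd//; exact: integrable_Gamma.
Qed.

Lemma Gamma_ge0 a : 0 <= Gamma a.
Proof. by apply: Rintegral_ge0 => t _; exact: g_ge0. Qed.

Let gS a t : 0 < a -> 0 < t -> g (a + 1) t = t * g a t.
Proof.
by move=> a0 t0; rewrite /g addrK mulrA mulr_powRB1// ltW.
Qed.

Lemma Gamma1 : Gamma 1 = 1 :> R.
Proof.
rewrite GammaE// (Rintegral_itv_obnd_cbnd (f := g 1)); last exact: integrable_Gamma.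
have r0 : 0 < 1 :> R by [].
rewrite -[RHS]/(fine 1%E) -(integral_exponential_pdf r0) integral_mkcond.
congr fine; rewrite [LHS]integral_mkcond; apply: eq_integral => t _ /=.
rewrite !patchE in_setT; case: ifPn => h.
  rewrite inE/= in_itv/= andbT in h.
  by rewrite exponential_pdfE// /g subrr powRr0 !mul1r mulN1r.
by rewrite /exponential_pdf patchE (negbTE h).
Qed.

(** The integrand of Gamma (a + 1) - a Gamma a is the derivative of
   - t^a e^(-t), and it has a constant sign on either side of a: the two
   integrals are opposite. *)
Lemma GammaS a : 0 < a -> Gamma (a + 1) = a * Gamma a.
Proof.
move=> a0; have a10 : 0 < a + 1 by rewrite addr_gt0.
pose f t := (a - t) * g a t.
pose F t := t `^ a * expR (- t).
have FD t : 0 < t -> is_derive t 1 F (f t).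
  move=> t0.
  have h1 : is_derive t 1 (fun t : R => expR (- t)) (- expR (- t)).
    have hN : is_derive t 1 (fun t : R => - t) (-1) by apply: is_deriveN.
    have := @is_derive1_comp R expR (fun t => - t) t _ _ (is_derive_expR _) hN.
    by rewrite mulrN1.
  have h2 := is_deriveM (is_derive1_powR a t0) h1.
  apply: is_derive_eq h2 _; rewrite /f /g /GRing.scale/=.
  by rewrite -(mulr_powRB1 (ltW t0) a0); ring.
have cf t : 0 < t -> {for t, continuous f}.
  move=> t0; apply: cvgM; first by apply: cvgB; [exact: cvg_cst|exact: cvg_id].
  apply: cvgM; first exact: continuous_powR.
  by apply: (@continuous_comp _ _ _ -%R expR); [exact: opp_continuous|exact: continuous_expR].
have cF t : 0 < t -> {for t, continuous F}.
  move=> t0; apply/differentiable_continuous/derivable1_diffP.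
  by have [] := FD _ t0.
have I1 : (\int[mu]_(t in `]0%R, a[) (f t)%:E = (F a - 0)%:E)%E.
  apply: (ge0_improper_FTC2 (F := F) a0).
  - by move=> t /andP[t0 ta]; rewrite mulr_ge0 ?g_ge0// subr_ge0 ltW.
  - by move=> t /andP[t0 _]; exact: cf.
  - by move=> t /andP[t0 _]; exact: FD.
  - have : F t @[t --> 0^'+] --> 0 * expR (- 0).
      apply: cvgM; first exact: powR_cvg0.
      apply: cvg_at_right_filter.
      by apply: (@continuous_comp _ _ _ -%R expR); [exact: opp_continuous|exact: continuous_expR].
    by rewrite mul0r.
  - by apply: cvg_at_left_filter; exact: cF.
have I2 : (\int[mu]_(t in `[a, +oo[) (- f t)%:E = (F a)%:E)%E.
  rewrite (@ge0_continuous_FTC2y _ _ (fun t => - F t) a 0)//.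
  - by rewrite sub0e -EFinN opprK.
  - by move=> t at_; rewrite -mulNr opprB mulr_ge0 ?g_ge0// subr_ge0.
  - apply: continuous_in_subspaceT => t; rewrite inE/= in_itv/= andbT => at_.
    by apply: cvgN; apply: cf; exact: lt_le_trans at_.
  - rewrite -oppr0; apply: cvgN.
    apply: (@squeeze_cvgr _ +oo _ R (cst 0) (fun t => (2 * a) `^ a * expR (- (t / 2)))).
    + near=> t; rewrite mulr_ge0 ?powR_ge0 ?expR_ge0//=.
      by apply: powR_expR_le => //; near: t; exact: nbhs_pinfty_ge.
    + exact: cvg_cst.
    + rewrite -(mulr0 ((2 * a) `^ a)); apply: cvgMr.
      have h : (x / 2 : R) @[x --> +oo] --> +oo by apply: gt0_cvgMly => //; exact: cvg_id.
      have k := cvg_comp _ _ h (@cvgr_expR R).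
      exact: k.
  - move=> t at_; apply: derivableN.
    by have [] := FD t (lt_trans a0 at_).
  - by apply: cvg_at_right_filter; apply: cvgN; exact: cF.
  - move=> t; rewrite in_itv/= andbT => at_; rewrite derive1E.
    have D := FD t (lt_trans a0 at_).
    by have [_ ->] := is_deriveN D.
have iG1 := integrable_Gamma a10; have iG := integrable_Gamma a0.
have itf : mu.-integrable `]0%R, +oo[ (EFin \o f).
  apply: eq_integrable_in (integrable_sub _ (integrable_scale a _ iG) iG1) => //.
  move=> t /=; rewrite in_itv/= andbT => t0.
  by rewrite /f gS// mulrBl.
have itf0 : mu.-integrable `]0%R, a[ (EFin \o f).
  by apply: integrable_subset itf => //; exact: subset_itvl.
have itfa : mu.-integrable `[a, +oo[ (EFin \o f).
  by apply: integrable_subset itf => //; apply: subset_itvr; rewrite bnd_simp.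
have f0 : \int[mu]_(t in `]0%R, +oo[) f t = 0.
  rewrite (@itv_bndbnd_setU _ _ _ (BLeft a)) ?bnd_simp//.
  rewrite Rintegral_setU//; last first.
  - apply/disj_setPS => t /=; rewrite !in_itv/=.
    by move=> [/andP[_ h1] /andP[h2 _]]; move: h1; rewrite ltNge h2.
  - by rewrite -itv_bndbnd_setU ?bnd_simp.
  have -> : \int[mu]_(t in `]0%R, a[) f t = F a by rewrite /Rintegral I1 /= subr0.
  have : \int[mu]_(t in `[a, +oo[) (0 - f t) = F a.
    by rewrite /Rintegral; under eq_integral do rewrite sub0r; rewrite I2.
  rewrite RintegralB//; last first.
    by apply: eq_integrable_in (integrable_scale 0 _ itfa) => // t _; rewrite mul0r.
  rewrite Rintegral_cst// mul0r sub0r => <-.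
  by rewrite addrC subrr.
rewrite !GammaE// -RintegralZl//; apply/eqP; rewrite eq_sym -subr_eq0 -RintegralB//; last first.
  exact: integrable_scale.
apply/eqP; rewrite -[RHS]f0; apply: eq_Rintegral => t; rewrite inE/= in_itv/= andbT => t0.
by rewrite /f gS// mulrBl.
Unshelve. all: by end_near. Qed.

(** Integrate the chord bound (t / x)^s <= 1 + s (t / x - 1) against
   t^(x - 1) e^(- t), for which t / x has mean value 1. *)
Lemma Gamma_add_le x s : 0 < x -> 0 <= s <= 1 -> Gamma (x + s) <= x `^ s * Gamma x.
Proof.
move=> x0 s01; have xs0 : 0 < x + s by case/andP: s01 => s0 _; rewrite ltr_wpDr.
have x10 : 0 < x + 1 by rewrite addr_gt0.
have iG1 := integrable_Gamma x10; have iG := integrable_Gamma x0.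
have iG2 := integrable_Gamma xs0.
have -> : x `^ s * Gamma x
  = \int[mu]_(t in `]0%R, +oo[) (x `^ s * (1 - s) * g x t - (- (x `^ s * s / x)) * g (x + 1) t).
  rewrite RintegralB ?RintegralZl -?GammaE//; try exact: integrable_scale.
  rewrite GammaS//; field; exact: lt0r_neq0.
rewrite GammaE//; apply: le_Rintegral => //.
  by apply: integrable_sub => //; exact: integrable_scale.
move=> t /=; rewrite in_itv/= andbT => t0.
rewrite gS//.
have -> : g (x + s) t = t `^ s * g x t.
  have e : x + s - 1 = s + (x - 1) by ring.
  by rewrite /g e (@powRD _ t s (x - 1)) ?mulrA// (gt_eqF t0) implybT.
have -> : x `^ s * (1 - s) * g x t - - (x `^ s * s / x) * (t * g x t)
   = x `^ s * (1 + s * (t / x - 1)) * g x t by ring.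
rewrite ler_wpM2r//.
have -> : t = x * (t / x) by field; rewrite gt_eqF.
rewrite powRM ?divr_ge0 ?(ltW x0) ?(ltW t0)// mulrAC divff ?gt_eqF// mul1r.
by rewrite ler_wpM2l ?powR_ge0// powR_le_chord// divr_gt0.
Qed.

Lemma Gamma_ge x : 0 < x <= 1 -> x `^ (x - 1) <= Gamma x.
Proof.
move=> /andP[x0 x1]; have s01 : 0 <= 1 - x <= 1 by rewrite subr_ge0 x1/= gerBl ltW.
have := Gamma_add_le x0 s01; rewrite addrC subrK Gamma1 => h.
by rewrite -opprB powRN -[leLHS]mul1r ler_pdivrMr ?powR_gt0// mulrC.
Qed.

Lemma Gamma_gt0 x : 0 < x <= 1 -> 0 < Gamma x.
Proof.
by move=> x01; apply: lt_le_trans (Gamma_ge x01); rewrite powR_gt0//; case/andP: x01.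
Qed.

Lemma Gamma_nat n : Gamma n.+1%:R = n`!%:R :> R.
Proof.
elim: n => [|n IHn]; first by rewrite Gamma1.
by rewrite -natr1 GammaS// IHn factS natrM.
Qed.

Lemma binserE a n : 0 < a <= 1 -> binser a n = Gamma (n%:R + a) / (Gamma a * n`!%:R).
Proof.
move=> a01; have a0 : 0 < a by case/andP: a01.
have Ga := Gamma_gt0 a01.
elim: n => [|n IHn]; first by rewrite binser0 add0r mulr1 divff ?gt_eqF.
rewrite binserS IHn -[in RHS]natr1 -(addrA n%:R) (addrC 1) addrA GammaS ?ltr_wpDl//.
have f0 : n`!%:R != 0 :> R by rewrite pnatr_eq0 -lt0n fact_gt0.
rewrite factS natrM; move: (n`!%:R) f0 (Gamma _) => m m0 G.
have n0 : n.+1%:R != 0 :> R by [].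
by move: (n.+1%:R) n0 => k k0; field; rewrite m0 k0 gt_eqF.
Qed.

(** Through [binserE], this lemma and the next one are Gautschi's inequalities
   between Gamma (n + a) and factorials, both contained in [Gamma_add_le]. *)
Lemma binser_Gamma_le a n : 0 < a <= 1 ->
  binser a n.+1 <= n.+1%:R `^ (a - 1) / Gamma a.
Proof.
move=> a01; have Ga := Gamma_gt0 a01; have a0 : 0 < a by case/andP: a01.
have n0 : 0 < n.+1%:R :> R by [].
have a01' : 0 <= a <= 1 by case/andP: a01 => /ltW -> ->.
have := Gamma_add_le n0 a01'; rewrite Gamma_nat binserE// factS natrM.
have f0 : 0 < n`!%:R :> R by rewrite ltr0n fact_gt0.
move: (n`!%:R) f0 (Gamma (_ + a)) => m m0 G h.
rewrite ler_pdivrMr; last by rewrite !mulr_gt0.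
apply: le_trans h _; rewrite -(mulr_powRB1 (ltW n0) a0).
by rewrite le_eqVlt; apply/orP; left; apply/eqP; field; rewrite gt_eqF.
Qed.

Lemma binser_Gamma_ge a n : 0 < a <= 1 -> n.+1%:R `^ (a - 1) / Gamma a <= binser a n.
Proof.
move=> a01; have Ga := Gamma_gt0 a01; have a0 : 0 < a by case/andP: a01.
have na0 : 0 < n%:R + a by rewrite ltr_wpDl.
have s01 : 0 <= 1 - a <= 1 by case/andP: a01 => _ a1; rewrite subr_ge0 a1/= gerBl ltW.
have := Gamma_add_le na0 s01; rewrite (_ : n%:R + a + (1 - a) = n.+1%:R); last first.
  by rewrite -natr1; ring.
rewrite Gamma_nat binserE//.
have f0 : 0 < n`!%:R :> R by rewrite ltr0n fact_gt0.
have := Gamma_ge0 (n%:R + a).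
move: (n`!%:R) f0 (Gamma (_ + a)) => m m0 G G0 h.
rewrite ler_pdivlMr; last by rewrite mulr_gt0.
rewrite mulrA divfK ?gt_eqF//.
apply: le_trans (ler_wpM2l (powR_ge0 _ _) h) _.
rewrite mulrA ler_piMl//.
rewrite -opprB powRN mulrC ler_pdivrMr ?powR_gt0// mul1r.
case/andP: s01 => s0 _; rewrite ge0_ler_powR ?nnegrE ?(ltW na0)//.
by rewrite -natr1 lerD2l; case/andP: a01.
Qed.

End GammaFunction.

(** * The renewal sequence of the memory kernel *)

Section Renewal.
Context {R : realType}.
Variable a : R.
Hypothesis a_bound : 2^-1 < a < 1.

Let a12 : 2^-1 < a. Proof. by case/andP: a_bound. Qed.
Let a1 : a < 1. Proof. by case/andP: a_bound. Qed.
Let a0 : 0 < a. Proof. by apply: lt_trans a12. Qed.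
Let b01 : 0 < 1 - a <= 1. Proof. by have := a12; have := a1; lra. Qed.
Let G := Gamma (1 - a).
Let G0 : 0 < G. Proof. exact: Gamma_gt0. Qed.

Let Gge : (1 - a) `^ (- a) <= G.
Proof. by have := Gamma_ge b01; rewrite (_ : 1 - a - 1 = - a)//; ring. Qed.

Let Gge2 : 2 `^ a <= G.
Proof.
apply: le_trans Gge.
have -> : 2 `^ a = (2^-1) `^ (- a).
  by rewrite powRN -[2 in LHS]invrK -powR_inv1 ?invr_ge0// powRAC powR_inv1 ?powR_ge0.
by apply: ler_powRN; have := a12; have := a1; lra.
Qed.

(** The pole of Gamma at 0 makes this small as a tends to 1. The exponent a that
   [Gamma_ge] gives is weakened to 1/2, its infimum. *)
Lemma invGamma_le : (Gamma (1 - a))^-1 <= (1 - a) `^ 2^-1.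
Proof.
have p0 : 0 < (1 - a) `^ (- a) by rewrite powR_gt0//; have := a1; lra.
apply: (@le_trans _ _ ((1 - a) `^ (- a))^-1); first by rewrite lef_pV2 ?posrE.
by rewrite -powRN opprK; apply: ger_powR; have := a12; have := a1; lra.
Qed.

Definition memory_tail n : R := if n is 0 then 1 else n%:R `^ (- a) / Gamma (1 - a).

Lemma memory_tailB n : memory_tail n - memory_tail n.+1 = phi a n.+1.
Proof.
by case: n => [|n]; rewrite /memory_tail /phi ?powR1 ?div1r// -mulrBl mulrC.
Qed.

Let tail_gt0 n : 0 < memory_tail n.
Proof. by case: n => [|n]//=; rewrite divr_gt0// powR_gt0. Qed.

Let tail_dec n : memory_tail n.+1 <= memory_tail n.
Proof.
case: n => [|n] /=.
  rewrite powR1 ler_pdivrMr// mul1r (le_trans _ Gge2)//.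
  by have := @ler_powR R 2 _ 0 a (ltW a0); rewrite powRr0; apply; lra.
by rewrite ler_pM2r ?invr_gt0// ler_powRN ?(ltW a0)// ler_nat.
Qed.

Let tail_logconvex n : memory_tail n.+1 ^+ 2 <= memory_tail n * memory_tail n.+2.
Proof.
case: n => [|n] /=.
  by rewrite powR1 !mul1r expr2 ler_pM2r ?invr_gt0// powRN lef_pV2 ?posrE ?powR_gt0.
rewrite exprMn [leRHS]mulrACA -/G -(expr2 G^-1) ler_pM2r ?exprn_gt0 ?invr_gt0//.
rewrite expr2 -!powRM// ler_powRN ?(ltW a0) ?mulr_gt0//.
by rewrite -!natrM ler_nat; lia.
Qed.

Let binser_tail n : binser (1 - a) n <= memory_tail n.
Proof.
case: n => [|n]; first by rewrite binser0.
by have := binser_Gamma_le n b01; rewrite (_ : 1 - a - 1 = - a)//; ring.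
Qed.

Let sum_tail n : \sum_(k < n.+1) (memory_tail k - binser (1 - a) k)
  <= (1 - n.+1%:R `^ (- a)) / G.
Proof.
elim: n => [|n IHn]; first by rewrite big_ord1 binser0 powR1 !subrr mul0r.
rewrite big_ord_recr/=; apply: le_trans (lerD IHn (lerB (lexx _) (binser_Gamma_ge n.+1 b01))) _.
rewrite (_ : 1 - a - 1 = - a); last by ring.
by rewrite -/G le_eqVlt; apply/orP; left; apply/eqP; field; rewrite gt_eqF.
Qed.

Lemma phi_ge0 n : 0 <= phi a n.
Proof. by case: n => [|n]//; rewrite -memory_tailB subr_ge0. Qed.

Lemma sum_phi_le1 n : \sum_(k < n.+1) phi a k <= 1.
Proof.
suff -> : \sum_(k < n.+1) phi a k = 1 - memory_tail n by rewrite gerBl ltW.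
elim: n => [|n IHn]; first by rewrite big_ord1 /= subrr.
rewrite big_ord_recr IHn (_ : phi a _ = memory_tail n - memory_tail n.+1).
  by rewrite /= addrA subrK.
by rewrite memory_tailB.
Qed.

(** Since 1 - phi = (1 - X) t with t the tail sums of phi, [resolvent_ex] applies:
   t is log-convex, and its excess over the coefficients of (1 - X)^(a - 1) sums
   to less than 1 / Gamma (1 - a), by the telescoping bound [sum_tail]. *)
Lemma renewal_ex : exists u : nat -> R, [/\ cauchyM u (unit_seq \- phi a) = unit_seq,
  forall n, 0 <= u n, forall n, u n <= n.+1%:R `^ (a - 1)
  & forall n, \sum_(k < n.+1) `|u k - binser a k|
       <= 2 * (1 - a) `^ 2^-1 / (2 * a - 1) * n.+1%:R `^ (2 * a - 1)].
Proof.
have [||u [ut u0 ule uv]] := @resolvent_ex R a ((1 - a) `^ 2^-1) memory_tail a_bound erefl tail_gt0 tail_dec tail_logconvex.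
- exact: binser_tail.
- move=> n; apply: le_trans (sum_tail n) _; apply: le_trans invGamma_le.
  by rewrite -/G ler_piMl ?invr_ge0 ?(ltW G0)// gerBl powR_ge0.
exists u; split => //.
suff -> : unit_seq \- phi a = cauchyM diff_seq memory_tail.
  by rewrite cauchyMCA ut cauchyM_diff_ones.
apply/funext => -[|n]; first by rewrite cauchyM_diff0 /unit_seq/= subr0.
rewrite cauchyM_diffS -[RHS]opprB memory_tailB.
by rewrite /unit_seq [LHS]/= sub0r.
Qed.

End Renewal.

(** * The fractional Volterra equation *)

Lemma predn_sub n m : (n.-1 - m)%N = (n - m.+1)%N.
Proof. by case: n => // n; rewrite subSS. Qed.

Lemma predn_subS n m : (m < n)%N -> (n.-1 - m).+1 = (n - m)%N.
Proof. by case: n => // n mn; rewrite subSn. Qed.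

Lemma predn_subKS n m : (m < n)%N -> (n.-1 - (n - m.+1))%N = m.
Proof. by case: n => // n mn; rewrite subSS subKn. Qed.

Lemma subn_predn_sub n m : (m < n)%N -> (n - (n.-1 - m))%N = m.+1.
Proof. by case: n => // n mn; rewrite subSn ?leq_subr// subKn. Qed.

Section Volterra.
Context {R : realType}.
Notation mu := (@lebesgue_measure R).
Variables (a T B : R) (y g : R -> R).
Hypothesis a01 : 0 < a <= 1.
Hypothesis y_int : forall t, 0 <= t <= T ->
  mu.-integrable `[0, t] (EFin \o (fun s => (t - s) `^ (a - 1) * g s)).
Hypothesis y_eq : forall t, 0 <= t <= T ->
  y t = (Gamma a)^-1 * \int[mu]_(s in `[0, t]) ((t - s) `^ (a - 1) * g s).
Hypothesis g_bound : forall s, 0 <= s <= T -> `|g s| <= B.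

Let a0 : 0 < a. Proof. by case/andP: a01. Qed.
Let G0 : 0 < Gamma a. Proof. exact: Gamma_gt0. Qed.

Let measurable_kernel t (D : set R) : measurable D ->
  measurable_fun D (fun s => (t - s) `^ (a - 1)).
Proof.
move=> mD; apply: measurable_funS (_ : measurable_fun setT _) => //.
apply: (@measurableT_comp _ _ _ _ _ _ (@powR R ^~ (a - 1))); first exact: measurable_powR.
by apply: measurable_funB => //; exact: measurable_cst.
Qed.

Let kernel_fin t x z : x <= z -> z <= t ->
  (\int[mu]_(s in `[x, z[) ((t - s) `^ (a - 1))%:E
     = (((t - x) `^ a - (t - z) `^ a) / a)%:E)%E.
Proof.
rewrite le_eqVlt => /predU1P[->|xz] zt.
  by rewrite set_itvco0 integral_set0 subrr mul0r.
rewrite integral_itv_bndoo ?integral_powR//.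
by apply/measurable_EFinP; apply: measurable_kernel.
Qed.

Let kernel_integrable t x z : x <= z -> z <= t ->
  mu.-integrable `[x, z[ (EFin \o (fun s => (t - s) `^ (a - 1))).
Proof.
move=> xz zt; apply: integrable_ge0 (kernel_fin xz zt) => [|s _]; last exact: powR_ge0.
exact: measurable_kernel.
Qed.

Let kernelE t x z : x <= z -> z <= t ->
  \int[mu]_(s in `[x, z[) ((t - s) `^ (a - 1)) = ((t - x) `^ a - (t - z) `^ a) / a.
Proof. by move=> xz zt; rewrite /Rintegral kernel_fin. Qed.

Let int_sub t x z : 0 <= t <= T -> 0 <= x -> z <= t ->
  mu.-integrable `[x, z[ (EFin \o (fun s => (t - s) `^ (a - 1) * g s)).
Proof.
move=> tT x0 zt; apply: integrable_subset (y_int tT) => //.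
by apply: subset_itvScc; rewrite bnd_simp.
Qed.

Let y_eqo t : 0 <= t <= T ->
  y t = (Gamma a)^-1 * \int[mu]_(s in `[0, t[) ((t - s) `^ (a - 1) * g s).
Proof.
move=> tT; rewrite y_eq// Rintegral_itv_bndo_bndc//; exact: int_sub.
Qed.

Let split_itv (f : R -> R) x m z : x <= m -> m <= z ->
  mu.-integrable `[x, z[ (EFin \o f) ->
  \int[mu]_(s in `[x, z[) f s
    = \int[mu]_(s in `[x, m[) f s + \int[mu]_(s in `[m, z[) f s.
Proof.
move=> xm mz; rewrite (@itv_bndbnd_setU _ _ _ (BLeft m)) ?bnd_simp// => fi.
rewrite Rintegral_setU//; apply/disj_setPS => s /=; rewrite !in_itv/=.
by move=> [/andP[_ h1] /andP[h2 _]]; move: h1; rewrite ltNge h2.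
Qed.

Let norm_le (f k : R -> R) x z :
  mu.-integrable `[x, z[ (EFin \o f) -> mu.-integrable `[x, z[ (EFin \o k) ->
  (forall s, x <= s < z -> `|f s| <= k s) ->
  `|\int[mu]_(s in `[x, z[) f s| <= \int[mu]_(s in `[x, z[) k s.
Proof.
move=> fi ki fk; apply: le_trans (le_normr_Rintegral _ fi) _ => //.
apply: le_Rintegral => //; first exact: integrable_norm.
Qed.

(** The increment of y collects the integral over [s, t] and the change of the
   kernel on [0, s]; the kernel decreases with time, so both are controlled by
   its primitive. *)
Lemma volterra_hoelder s t : 0 <= s -> s <= t -> t <= T ->
  `|y t - y s| <= 2 * B / (a * Gamma a) * (t - s) `^ a.
Proof.
move=> s0 st tT; have t0 := le_trans s0 st; have sT := le_trans st tT.
have tT' : 0 <= t <= T by rewrite t0. have sT' : 0 <= s <= T by rewrite s0.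
have B0 : 0 <= B by apply: le_trans (g_bound sT').
pose k u x := (u - x) `^ (a - 1).
rewrite !y_eqo// (split_itv s0 st) ?int_sub// -mulrBr normrM ger0_norm ?invr_ge0 ?(ltW G0)//.
rewrite addrAC -RintegralB ?int_sub//.
have h1 : `|\int[mu]_(x in `[0, s[) (k t x * g x - k s x * g x)|
    <= B * (((s - 0) `^ a - (s - s) `^ a) / a) - B * (((t - 0) `^ a - (t - s) `^ a) / a).
  rewrite -!kernelE// -!RintegralZl ?kernel_integrable// -RintegralB; try by [|exact: integrable_scale (kernel_integrable _ _)].
  apply: norm_le.
  - by apply: integrable_sub => //; apply: int_sub.
  - by apply: integrable_sub => //; apply: integrable_scale => //; exact: kernel_integrable.
  - move=> x /andP[x0 xs]; rewrite -mulrBl normrM -mulrBr mulrC.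
    have xT : 0 <= x <= T by rewrite x0 (le_trans (ltW xs)).
    rewrite ler_pM ?g_bound// distrC ger0_norm// subr_ge0.
    by apply: ler_powRB1; [case/andP: a01|rewrite subr_gt0|rewrite lerD2r].
have h2 : `|\int[mu]_(x in `[s, t[) (k t x * g x)| <= B * (((t - s) `^ a - (t - t) `^ a) / a).
  rewrite -kernelE// -RintegralZl ?kernel_integrable//; apply: norm_le.
  - exact: int_sub.
  - by apply: integrable_scale => //; exact: kernel_integrable.
  - move=> x /andP[sx xt]; rewrite normrM mulrC (ger0_norm (powR_ge0 _ _)).
    by rewrite ler_wpM2r ?powR_ge0// g_bound// (le_trans s0 sx) (le_trans (ltW xt)).
apply: le_trans (ler_wpM2l _ (le_trans (ler_normD _ _) (lerD h1 h2))) _.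
  by rewrite invr_ge0 ltW.
have sta : s `^ a <= t `^ a by rewrite ge0_ler_powR ?(ltW a0) ?nnegrE.
rewrite !subrr powR0 ?gt_eqF// !subr0.
have -> : 2 * B / (a * Gamma a) * (t - s) `^ a
   = (Gamma a)^-1 * (2 * (B / a) * (t - s) `^ a) by field; rewrite !gt_eqF.
rewrite ler_wpM2l ?invr_ge0 ?(ltW G0)// -subr_ge0.
have -> : 2 * (B / a) * (t - s) `^ a - (B * (s `^ a / a) - B * ((t `^ a - (t - s) `^ a) / a)
   + B * ((t - s) `^ a / a)) = B / a * (t `^ a - s `^ a) by field; rewrite !gt_eqF.
by rewrite mulr_ge0 ?subr_ge0// divr_ge0// ltW.
Qed.

Variables (L dt : R).
Hypothesis g_hoelder : forall s t, 0 <= s -> s <= t -> t <= T ->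
  `|g t - g s| <= L * (t - s) `^ a.
Hypothesis L0 : 0 <= L.
Hypothesis dt0 : 0 < dt.

Let w n : R := (n.+1%:R `^ a - n%:R `^ a) / a.

Let w_ge n : n.+1%:R `^ (a - 1) <= w n.
Proof.
rewrite /w ler_pdivlMr// mulrC.
have n1 : 1 <= n.+1%:R :> R by rewrite ler1n.
by have := powR_incr_ge a01 n1; rewrite (_ : n.+1%:R - 1 = n%:R)// -natr1 addrK.
Qed.

Let w_le n : w n.+1 <= n.+1%:R `^ (a - 1).
Proof.
rewrite /w ler_pdivrMr// mulrC -natr1.
by have := @powR_incr_le R a n.+1%:R a01; apply.
Qed.

(* On each cell, g is replaced by its value at the right end, at a cost of
   L dt^a times the mass of the kernel. *)
Let cells n m : (m <= n)%N -> n%:R * dt <= T ->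
  `|\int[mu]_(s in `[0, (m%:R * dt)[) ((n%:R * dt - s) `^ (a - 1) * g s)
     - dt `^ a * \sum_(k < m) w (n.-1 - k)%N * g (k.+1%:R * dt)|
  <= L * dt `^ a * (dt `^ a * \sum_(k < m) w (n.-1 - k)%N).
Proof.
move=> mn nT; elim: m mn => [|m IHm] mn.
  by rewrite mul0r set_itvco0 Rintegral_set0 !big_ord0 !mulr0 subrr normr0.
have dtw := ltW dt0.
have t0 : 0 <= n%:R * dt by rewrite mulr_ge0.
have mm : m%:R * dt <= m.+1%:R * dt by rewrite ler_wpM2r// ler_nat.
have m0 : 0 <= m%:R * dt by rewrite mulr_ge0.
have mn' : m.+1%:R * dt <= n%:R * dt by rewrite ler_wpM2r// ler_nat.
have tT : 0 <= n%:R * dt <= T by rewrite t0.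
rewrite (split_itv m0 mm) ?int_sub// !big_ord_recr/= !mulrDr.
set gk := g (m.+1%:R * dt).
have wE : dt `^ a * w (n.-1 - m)%N = \int[mu]_(s in `[(m%:R * dt), (m.+1%:R * dt)[)
    ((n%:R * dt - s) `^ (a - 1)).
  rewrite kernelE// -!mulrBl /w -!natrB ?(ltnW mn)//.
  rewrite predn_subS// predn_sub.
  by rewrite !powRM//; ring.
rewrite opprD addrACA; apply: le_trans (ler_normD _ _) _; apply: lerD.
  by apply: IHm; exact: ltnW.
rewrite mulrA wE.
have -> : (\int[mu]_(s in `[(m%:R * dt), (m.+1%:R * dt)[) ((n%:R * dt - s) `^ (a - 1))) * gk
  = \int[mu]_(s in `[(m%:R * dt), (m.+1%:R * dt)[) (gk * (n%:R * dt - s) `^ (a - 1)).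
  by rewrite RintegralZl ?kernel_integrable// mulrC.
rewrite -RintegralB ?int_sub//; last by apply: integrable_scale => //; exact: kernel_integrable.
rewrite -RintegralZl ?kernel_integrable//; apply: norm_le.
- apply: integrable_sub => //; first exact: int_sub.
  by apply: integrable_scale => //; exact: kernel_integrable.
- by apply: integrable_scale => //; exact: kernel_integrable.
- move=> s /andP[ms sm]; rewrite mulrC -mulrBl normrM [X in _ * X]ger0_norm ?powR_ge0//.
  rewrite ler_wpM2r ?powR_ge0// distrC.
  apply: le_trans (g_hoelder (le_trans m0 ms) (ltW sm) (le_trans mn' nT)) _.
  rewrite ler_wpM2l// ge0_ler_powR ?(ltW a0) ?nnegrE ?subr_ge0 ?(ltW sm)//.
  by rewrite lerBlDr -[X in X + _]mul1r (le_trans _ (lerD (lexx _) ms))// -mulrDl addrC natr1.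
Qed.

(** The integral over a cell of the time grid is compared with the value at its
   right end; the weights of the cells then differ from the binomial sequence
   by a summable amount, as both lie between consecutive values of a monotone
   function. *)
Lemma volterra_binser n : n%:R * dt <= T ->
  `|y (n%:R * dt) - dt `^ a * cauchyM (binser a) (fun k => g (k%:R * dt)) n|
  <= (L * (T `^ a / (a * Gamma a)) + B * ((a * Gamma a)^-1 + 2 + (Gamma a)^-1)) * dt `^ a.
Proof.
move=> nT; have dta := powR_ge0 dt a; have dtw := ltW dt0.
have t0 : 0 <= n%:R * dt by rewrite mulr_ge0.
have tT : 0 <= n%:R * dt <= T by rewrite t0.
have T0 : 0 <= T by exact: le_trans nT.
have B0 : 0 <= B by apply: le_trans (g_bound tT).
have v0 k : 0 <= binser a k by rewrite ltW ?binser_gt0.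
pose gt k := g (k%:R * dt).
have gtB k : (k <= n)%N -> `|gt k| <= B.
  move=> kn; apply: g_bound; rewrite mulr_ge0//= (le_trans _ nT)//.
  by rewrite ler_wpM2r// ler_nat.
have rev (F : nat -> R) : \sum_(k < n) F (n.-1 - k)%N = \sum_(k < n) F k.
  rewrite (reindex_inj rev_ord_inj); apply: eq_bigr => -[k kn] _ /=.
  by rewrite predn_subKS.
have c1 := cells (leqnn n) nT.
have e1 : \sum_(k < n) w (n.-1 - k)%N * g (k.+1%:R * dt) = \sum_(k < n) w k * gt (n - k)%N.
  rewrite -(rev (fun k => w k * gt (n - k)%N)); apply: eq_bigr => -[k kn] _ /=.
  by rewrite /gt subn_predn_sub.
have e2 : \sum_(k < n) w (n.-1 - k)%N = n%:R `^ a / a.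
  rewrite (rev w); move: (n) => j; elim: j => [|m IHm]; first by rewrite big_ord0 powR0 ?mul0r ?gt_eqF.
  by rewrite big_ord_recr/= IHm /w; field; rewrite gt_eqF.
have e3 : cauchyM (binser a) gt n = \sum_(k < n) binser a k * gt (n - k)%N + binser a n * gt 0%N.
  by rewrite /cauchyM big_ord_recr/= subnn.
have d1 m : \sum_(k < m) `|w k / Gamma a - binser a k| <= (a * Gamma a)^-1 + 1 + (Gamma a)^-1.
  have i0 : 0 <= (Gamma a)^-1 by rewrite invr_ge0 ltW.
  have i1 : 0 <= (a * Gamma a)^-1 by rewrite invr_ge0 mulr_ge0// ltW.
  case: m => [|m]; first by rewrite big_ord0; lra.
  suff h : \sum_(k < m.+1) `|w k / Gamma a - binser a k|
      <= (a * Gamma a)^-1 + 1 + (1 - m.+1%:R `^ (a - 1)) / Gamma a.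
    apply: le_trans h _; rewrite lerD2l ler_piMl// gerBl powR_ge0//.
  elim: m => [|m IHm].
    rewrite big_ord1 binser0 /w powR1 powR0 ?gt_eqF// subr0 subrr mul0r addr0.
    rewrite div1r -invfM (le_trans (ler_normB _ _))//.
    by rewrite normr1 ger0_norm.
  rewrite big_ord_recr/=; apply: le_trans (lerD IHm (_ : _ <= (m.+1%:R `^ (a - 1) - m.+2%:R `^ (a - 1)) / Gamma a)) _.
    have h1 := binser_Gamma_le m a01; have h2 := binser_Gamma_ge m.+1 a01.
    have h3 : w m.+1 / Gamma a <= m.+1%:R `^ (a - 1) / Gamma a by rewrite ler_wpM2r.
    have h4 : m.+2%:R `^ (a - 1) / Gamma a <= w m.+1 / Gamma a by rewrite ler_wpM2r.
    by rewrite mulrBl ler_norml; apply/andP; split; lra.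
  by rewrite -!addrA lerD2l lerD2l -mulrDl addrA subrK.
have vn : binser a n <= 1.
  apply: le_trans (binser_le n a01) _.
  apply: (@le_trans _ _ (1 `^ (a - 1))); last by rewrite powR1.
  by apply: ler_powRB1; [case/andP: a01|by []|rewrite ler1n].
rewrite y_eqo// e1 e2 in c1 *; rewrite -/gt e3.
set I := \int[mu]_(_ in _) _ in c1 *.
have -> : (Gamma a)^-1 * I - dt `^ a * (\sum_(k < n) binser a k * gt (n - k)%N + binser a n * gt 0)
  = (Gamma a)^-1 * (I - dt `^ a * \sum_(k < n) w k * gt (n - k)%N)
    + dt `^ a * (\sum_(k < n) (w k / Gamma a - binser a k) * gt (n - k)%N - binser a n * gt 0).
  have -> : \sum_(k < n) (w k / Gamma a - binser a k) * gt (n - k)%N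
    = (Gamma a)^-1 * \sum_(k < n) w k * gt (n - k)%N - \sum_(k < n) binser a k * gt (n - k)%N.
    by rewrite mulr_sumr -sumrB; apply: eq_bigr => k _; ring.
  ring.
rewrite mulrDl; apply: le_trans (ler_normD _ _) _; apply: lerD.
  rewrite normrM ger0_norm ?invr_ge0 ?(ltW G0)//.
  apply: le_trans (ler_wpM2l _ c1) _; first by rewrite invr_ge0 ltW.
  rewrite (mulrA (dt `^ a)) -powRM// (mulrC dt).
  have -> : (Gamma a)^-1 * (L * dt `^ a * ((n%:R * dt) `^ a / a))
    = L * ((n%:R * dt) `^ a / (a * Gamma a)) * dt `^ a by field; rewrite !gt_eqF.
  rewrite ler_wpM2r// ler_wpM2l// ler_wpM2r ?invr_ge0 ?mulr_ge0 ?(ltW a0) ?(ltW G0)//.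
  by rewrite ge0_ler_powR ?(ltW a0).
rewrite normrM ger0_norm// mulrC ler_wpM2r//.
apply: (@le_trans _ _ (B * ((a * Gamma a)^-1 + 1 + (Gamma a)^-1) + B * 1)); last by lra.
apply: le_trans (ler_normB _ _) _; apply: lerD.
  apply: le_trans (ler_norm_sum _ _ _) _.
  apply: le_trans (ler_wpM2l B0 (d1 n)); rewrite mulr_sumr.
  apply: ler_sum => -[k kn] _ /=; rewrite normrM mulrC ler_wpM2r// gtB//.
  exact: leq_subr.
by rewrite normrM mulrC ler_pM// ?gtB// ger0_norm.
Qed.

End Volterra.

(** * Modulus and exponential of complex numbers *)

Section ComplexModulus.
Context {R : realType}.
Implicit Types (x y z w : R[i]).

Lemma normc_ge0 x : 0 <= normc x.
Proof. by case: x => a b; exact: sqrtr_ge0. Qed.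

Lemma normc_C (a : R) : normc a%:C = `|a|.
Proof. by rewrite /normc /= expr0n/= addr0 sqrtr_sqr. Qed.

Lemma normcE_norm x : (normc x)%:C = `|x|.
Proof. by case: x. Qed.

Lemma normcD_le x y : normc (x + y) <= normc x + normc y.
Proof. by rewrite -lecR rmorphD/= !normcE_norm ler_normD. Qed.

Lemma normc_opp x : normc (- x) = normc x.
Proof. by apply: complexI; rewrite !normcE_norm normrN. Qed.

Lemma normcB_le x y : normc (x - y) <= normc x + normc y.
Proof. by rewrite -(normc_opp y) normcD_le. Qed.

Lemma normc_sum_le (I : Type) (s : seq I) (P : pred I) (f : I -> R[i]) :
  normc (\sum_(i <- s | P i) f i) <= \sum_(i <- s | P i) normc (f i).
Proof.
elim/big_rec2: _ => [|i a b _ h]; first by rewrite normc0.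
by apply: le_trans (normcD_le _ _) _; rewrite lerD2l.
Qed.

Lemma normcX x n : normc (x ^+ n) = normc x ^+ n.
Proof. by elim: n => [|n IHn]; rewrite ?normc1// !exprS normcM IHn. Qed.

Lemma normc_Re x : `|Re x| <= normc x.
Proof.
case: x => a b /=; rewrite -sqrtr_sqr ler_sqrt ?addr_ge0 ?sqr_ge0//.
by rewrite lerDl sqr_ge0.
Qed.

Lemma normc_Im x : `|Im x| <= normc x.
Proof.
case: x => a b /=; rewrite -sqrtr_sqr ler_sqrt ?addr_ge0 ?sqr_ge0//.
by rewrite lerDr sqr_ge0.
Qed.

Lemma normc_le_ReIm x : normc x <= `|Re x| + `|Im x|.
Proof.
case: x => a b /=; rewrite -[leRHS]ger0_norm ?addr_ge0// -sqrtr_sqr ler_sqrt ?sqr_ge0//.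
rewrite sqrrD !real_normK ?num_real// addrAC lerDl mulrn_wge0// mulr_ge0//.
Qed.

End ComplexModulus.

Section ComplexExponential.
Context {R : realType}.
Implicit Types (x : R) (w : R[i]).

Lemma normc_cexp w : normc (cexp w) = expR (Re w).
Proof.
rewrite /cexp /normc !exprMn -mulrDr cos2Dsin2 mulr1.
by rewrite sqrtr_sqr ger0_norm ?expR_ge0.
Qed.

(* Each application of the mean value theorem raises the order of vanishing at 0
   by one. *)
Let deriv_bound (f df : R -> R) (c : R) k : f 0 = 0 ->
  (forall x, is_derive x 1 f (df x)) ->
  (forall x, `|x| <= 1 -> `|df x| <= c * `|x| ^+ k) ->
  forall x, `|x| <= 1 -> `|f x| <= c * `|x| ^+ k.+1.
Proof.
move=> f0 fd dfc x x1.
have c0 : 0 <= c.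
  have : `|1 : R| <= 1 by rewrite normr1.
  by move=> /dfc; rewrite normr1 expr1n mulr1; exact: le_trans.
have fc (a b : R) : {within `[a, b], continuous f}.
  by apply: derivable_within_continuous => t _; have [] := fd t.
have key y : `|y| <= `|x| -> `|df y * x| <= c * `|x| ^+ k.+1.
  move=> yx; rewrite normrM exprSr mulrA ler_wpM2r//.
  apply: le_trans (dfc _ (le_trans yx x1)) _.
  by rewrite ler_wpM2l// lerXn2r ?nnegrE.
have [x0|x0|->] := ltgtP x 0; last 1 first.
- by rewrite f0 normr0 mulr_ge0// exprn_ge0.
- have [y] := MVT x0 (fun t _ => fd t) (fc _ _).
  rewrite in_itv/= f0 !sub0r => /andP[xy y0] e.
  rewrite -normrN e mulrN normrN; apply: key.
  by rewrite !ltr0_norm// lerN2 ltW.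
- have [y] := MVT x0 (fun t _ => fd t) (fc _ _).
  rewrite in_itv/= f0 !subr0 => /andP[y0 xy] e.
  rewrite e; apply: key.
  by rewrite !gtr0_norm// ltW.
Qed.

Let sin_bound x : `|x| <= 1 -> `|sin x| <= 1 * `|x| ^+ 1.
Proof.
apply: (@deriv_bound sin cos 1 0); rewrite ?sin0// => y _.
by rewrite expr0 mulr1 ler_norml cos_geN1 cos_le1.
Qed.

Let cos_bound x : `|x| <= 1 -> `|cos x - 1| <= 1 * `|x| ^+ 2.
Proof.
apply: (@deriv_bound (fun x => cos x - 1) (fun x => - sin x)).
- by rewrite cos0 subrr.
- move=> y; rewrite -[- sin y]subr0; apply: is_deriveB.
- by move=> y y1; rewrite normrN; exact: sin_bound.
Qed.

Let sin_bound3 x : `|x| <= 1 -> `|sin x - x| <= 1 * `|x| ^+ 3.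
Proof.
apply: (@deriv_bound (fun x => sin x - x) (fun x => cos x - 1)).
- by rewrite sin0 subrr.
- by move=> y y1; exact: cos_bound.
Qed.

Let is_derive_half_sqr x : is_derive x 1 (fun y : R => y ^+ 2 / 2) x.
Proof.
by apply: is_derive_eq; rewrite /GRing.scale/= !mulr1; field.
Qed.

Let cos_bound3 x : `|x| <= 1 -> `|cos x - 1 + x ^+ 2 / 2| <= 1 * `|x| ^+ 4.
Proof.
apply: (@deriv_bound (fun x => cos x - 1 + x ^+ 2 / 2) (fun x => - (sin x - x))).
- by rewrite cos0 subrr expr0n/= mul0r addr0.
- move=> y; rewrite opprB addrC -[- sin y]subr0.
  by apply: is_deriveD; apply: is_derive_half_sqr.
- by move=> y y1; rewrite normrN; exact: sin_bound3.
Qed.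

Let exp_bound x : `|x| <= 1 -> `|expR x - 1| <= expR 1 * `|x| ^+ 1.
Proof.
apply: (@deriv_bound (fun x => expR x - 1) expR).
- by rewrite expR0 subrr.
- by move=> y; rewrite -[expR y]subr0; apply: is_deriveB.
- move=> y y1; rewrite expr0 mulr1 ger0_norm ?expR_ge0// ler_expR.
  by apply: le_trans y1; exact: ler_norm.
Qed.

Let exp_bound2 x : `|x| <= 1 -> `|expR x - 1 - x| <= expR 1 * `|x| ^+ 2.
Proof.
apply: (@deriv_bound (fun x => expR x - 1 - x) (fun x => expR x - 1)).
- by rewrite expR0 subrr subr0.
- by move=> y; apply: is_deriveB; rewrite -[expR y]subr0; apply: is_deriveB.
- by move=> y y1; exact: exp_bound.
Qed.

Let exp_bound3 x : `|x| <= 1 -> `|expR x - 1 - x - x ^+ 2 / 2| <= expR 1 * `|x| ^+ 3.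
Proof.
apply: (@deriv_bound (fun x => expR x - 1 - x - x ^+ 2 / 2) (fun x => expR x - 1 - x)).
- by rewrite expR0 subrr expr0n/= mul0r !subr0.
- move=> y; apply: is_deriveB; last exact: is_derive_half_sqr.
  by apply: is_deriveB; rewrite -[expR y]subr0; apply: is_deriveB.
- by move=> y y1; exact: exp_bound2.
Qed.

(** The real and imaginary parts are products of real functions; their Taylor
   remainders follow from [deriv_bound], and what remains of the products of
   Taylor polynomials has order at least 3. *)
Lemma cexp_taylor : exists2 K : R, 0 <= K & forall w, normc w <= 1 ->
  normc (cexp w - (1 + w + w ^+ 2 / 2)) <= K * normc w ^+ 3.
Proof.
have E0 : 0 < expR 1 :> R := expR_gt0 1.
exists (8 + 2 * expR 1); first by lra.
move=> w w1; set m := normc w in w1 *; have m0 : 0 <= m := normc_ge0 w.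
have := normc_Re w; have := normc_Im w; rewrite -/m.
case: w @m w1 m0 => a b m w1 m0 bm' am'.
have bm : `|b| <= m := bm'; have am : `|a| <= m := am'.
have a1 := le_trans am w1; have b1 := le_trans bm w1.
have m3 k : (3 <= k)%N -> m ^+ k <= m ^+ 3 by move=> k3; rewrite ler_wiXn2l.
set ra := expR a - 1 - a - a ^+ 2 / 2; set rc := cos b - 1 + b ^+ 2 / 2.
set rs := sin b - b; set q := 1 + a + a ^+ 2 / 2.
have pm k x : `|x| <= m -> `|x| ^+ k <= m ^+ k by move=> xm; rewrite lerXn2r ?nnegrE.
have hra : `|ra| <= expR 1 * m ^+ 3.
  apply: le_trans (exp_bound3 a1) _; by rewrite ler_wpM2l ?(ltW E0) ?(pm _ _ am).
have hrc : `|rc| <= m ^+ 3.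
  by apply: le_trans (cos_bound3 b1) _; rewrite mul1r (le_trans (pm _ _ bm))// m3.
have hrs : `|rs| <= m ^+ 3.
  by apply: le_trans (sin_bound3 b1) _; rewrite mul1r pm.
have hq : `|q| <= 5 / 2.
  apply: le_trans (ler_normD _ _) _; apply: le_trans (lerD (ler_normD _ _) (lexx _)) _.
  rewrite normr1 normrM normrX (ger0_norm (_ : 0 <= 2^-1))//.
  have : `|a| ^+ 2 <= 1 by rewrite exprn_ile1.
  by lra.
have hcos : `|cos b| <= 1 by rewrite ler_norml cos_geN1 cos_le1.
have hsin : `|sin b| <= 1 by rewrite ler_norml sin_geN1 sin_le1.
have m30 : 0 <= m ^+ 3 by rewrite exprn_ge0.
have hqr r : `|r| <= m ^+ 3 -> `|q * r| <= 5 / 2 * m ^+ 3.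
  by move=> h; rewrite normrM ler_pM.
have hrr r : `|r| <= 1 -> `|ra * r| <= expR 1 * m ^+ 3.
  by move=> h; rewrite normrM -[leRHS]mulr1 ler_pM.
have hre : `|- (b ^+ 2 / 2 * (a + a ^+ 2 / 2))| <= m ^+ 3.
  rewrite normrN (_ : _ * _ = (b ^+ 2 * a) * ((1 + a / 2) / 2)); last by field.
  rewrite -[leRHS]mulr1 normrM ler_pM//.
    by rewrite normrM normrX [leRHS]exprSr ler_pM ?exprn_ge0 ?pm.
  move: a1; rewrite !ler_norml; lra.
have him : `|a ^+ 2 * b / 2| <= m ^+ 3.
  rewrite -[leRHS]mulr1 normrM ler_pM//.
    by rewrite normrM normrX [leRHS]exprSr ler_pM ?exprn_ge0 ?pm.
  by rewrite ger0_norm//; lra.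
have v2 : (2 : R[i])^-1 = (2^-1 : R)%:C by rewrite fmorphV rmorph_nat.
set d := cexp _ - _.
have dre : Re d = - (b ^+ 2 / 2 * (a + a ^+ 2 / 2)) + q * rc + ra * cos b.
  by rewrite /d v2 expr2 /q /rc /ra /=; field.
have dim : Im d = a ^+ 2 * b / 2 + q * rs + ra * sin b.
  by rewrite /d v2 expr2 /q /rs /ra /=; field.
apply: le_trans (normc_le_ReIm _) _; rewrite dre dim.
have h1 := le_trans (ler_normD _ _) (lerD (le_trans (ler_normD _ _) (lerD hre (hqr _ hrc))) (hrr _ hcos)).
have h2 := le_trans (ler_normD _ _) (lerD (le_trans (ler_normD _ _) (lerD him (hqr _ hrs))) (hrr _ hsin)).
by apply: le_trans (lerD h1 h2) _; nra.
Qed.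

End ComplexExponential.

(** * One step of the scheme *)

Section OneStep.
Context {R : realType}.

(** Divided by 2 k^2 e, the linear terms of the exponents x and y sum to
   P - e (z / 2 + g P), because b + c = 1, and the leading part of the quadratic
   ones supplies the other terms of the Riccati right-hand side. What is left is
   the difference of x^2 + y^2 and its leading part, written with differences of
   squares so that each factor is affine in z and P with bounded coefficients. *)
Lemma one_step_expansion (F : fieldType) (k e g b z P : F) :
    k != 0 -> e != 0 -> 2 != 0 :> F ->
  let c := 1 - b in
  let x := z * (k * e - k ^+ 2 * e ^+ 2) + b * (1 - g * e) * (2 * k ^+ 2 * e) * P in
  let y := - z * (k * e) + c * (1 - g * e) * (2 * k ^+ 2 * e) * P in
  (2 * k ^+ 2 * e)^-1 * (x + y + (x ^+ 2 + y ^+ 2) / 2) - P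
   - e * ((z ^+ 2 - z) / 2 + (k * (b - c) * z - g) * P
          + k ^+ 2 * (b ^+ 2 + c ^+ 2) * P ^+ 2)
  = e ^+ 2 * (2 * k ^- 2 / 4)
    * ((- z * k ^+ 2 - 2 * g * k ^+ 2 * b * P)
         * (z * (k - k ^+ 2 * e / 2) + b * (2 - g * e) * k ^+ 2 * P)
       + (- (2 * g * k ^+ 2 * c) * P)
         * (- z * k + c * (2 - g * e) * k ^+ 2 * P)).
Proof.
move=> k0 e0 two0 c x y; rewrite /x /y /c; field.
by rewrite k0 e0 two0 -[4]/((2 * 2)%:R) natrM mulf_neq0.
Qed.

(** The number X bounds both exponents divided by e, so that e X <= 1 puts them in
   the range of [cexp_taylor]; the cubic remainder, divided by 2 k^2 e, and the
   remainder of [one_step_expansion] are then both of order e^2. *)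
Lemma one_step (k g b c Z B : R) : 0 < k -> 0 <= g -> 0 <= b -> 0 <= c ->
    b + c = 1 -> 0 <= Z -> 0 <= B ->
  exists C X : R, [/\ 0 <= C, 0 <= X & forall (e : R) (z P : R[i]),
    0 < e <= 1 -> e * X <= 1 -> normc z <= Z -> normc P <= B ->
    normc (((2 * k ^+ 2 * e)^-1)%:C
         * (cexp (z * (k * e - k ^+ 2 * e ^+ 2)%:C
                  + (b * (1 - g * e) * (2 * k ^+ 2 * e))%:C * P)
            + cexp (- z * (k * e)%:C + (c * (1 - g * e) * (2 * k ^+ 2 * e))%:C * P)
            - 2) - P
       - e%:C * ((z ^+ 2 - z) / 2 + ((k * (b - c))%:C * z - g%:C) * P
                 + (k ^+ 2 * (b ^+ 2 + c ^+ 2))%:C * P ^+ 2))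
      <= C * e ^+ 2].
Proof.
move=> k0 g0 b0 c0 bc Z0 B0.
have [K K0 taylor] := @cexp_taylor R.
pose X := Z * (k + k ^+ 2) + 2 * k ^+ 2 * (1 + g) * B.
have k20 : 0 < k ^+ 2 by rewrite exprn_gt0.
have X0 : 0 <= X by rewrite /X !(addr_ge0, mulr_ge0)// ltW.
exists ((X ^+ 2 + K * X ^+ 3) / k ^+ 2), X.
split=> // [|e z P /andP[e0 e1] eX zZ PB].
  by rewrite divr_ge0 ?(ltW k20)// addr_ge0 ?mulr_ge0 ?exprn_ge0.
set x := (X in cexp X + _); set y := (X in _ + cexp X); set q := (_^-1)%:C.
have cE : c = 1 - b by rewrite -bc addrC addKr.
have b1 : b <= 1 by rewrite -bc lerDl.
have c1 : c <= 1 by rewrite -bc lerDr.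
have ge0 : 0 <= g * e by rewrite mulr_ge0// ltW.
have geg : g * e <= g by rewrite ler_piMr.
have linB (s u : R) : `|s| <= k + k ^+ 2 -> `|u| <= 2 * k ^+ 2 * (1 + g) ->
    normc (z * s%:C + u%:C * P) <= X.
  move=> hs hu; apply: le_trans (normcD_le _ _) _; rewrite !normcM !normc_C.
  by apply: lerD; rewrite ler_pM ?normc_ge0.
have gB (s : R) : 0 <= s <= 1 -> `|s * (1 - g * e) * (2 * k ^+ 2)| <= 2 * k ^+ 2 * (1 + g).
  move=> /andP[s0 s1]; rewrite normrM mulrC [X in X * _]ger0_norm; last by rewrite mulr_ge0// ltW.
  rewrite ler_pM2l; last by rewrite mulr_gt0.
  rewrite normrM -[leRHS]mul1r ler_pM//; first by rewrite ger0_norm.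
  by rewrite ler_norml; apply/andP; split; lra.
have ke0 : 0 <= k * e by rewrite mulr_ge0 ?ltW.
have kek : k * e <= k by rewrite ler_piMr ?(ltW k0).
have k2e0 : 0 <= k ^+ 2 * e by rewrite mulr_ge0 ?ltW.
have k2e : k ^+ 2 * e <= k ^+ 2 by rewrite ler_piMr ?(ltW k20).
have lin s u : z * (s * e)%:C + (u * e)%:C * P = e%:C * (z * s%:C + u%:C * P).
  by rewrite !rmorphM; ring.
have xB : normc x <= e * X.
  have -> : x = e%:C * (z * (k - k ^+ 2 * e)%:C + (b * (1 - g * e) * (2 * k ^+ 2))%:C * P).
    by rewrite -lin /x; congr (_ * _%:C + _%:C * _); ring.
  rewrite normcM normc_C gtr0_norm// ler_pM2l//; apply: linB; last by rewrite gB ?b0.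
  by rewrite ler_norml; apply/andP; split; lra.
have yB : normc y <= e * X.
  have -> : y = e%:C * (z * (- k)%:C + (c * (1 - g * e) * (2 * k ^+ 2))%:C * P).
    rewrite -lin /y mulNr -mulrN -rmorphN; congr (_ * _%:C + _%:C * _); ring.
  rewrite normcM normc_C gtr0_norm// ler_pM2l//; apply: linB; last by rewrite gB ?c0.
  by rewrite normrN gtr0_norm//; lra.
pose rx := cexp x - (1 + x + x ^+ 2 / 2); pose ry := cexp y - (1 + y + y ^+ 2 / 2).
have rB w : normc w <= e * X -> normc (cexp w - (1 + w + w ^+ 2 / 2)) <= K * X ^+ 3 * e ^+ 3.
  move=> wX; apply: le_trans (taylor w (le_trans wX eX)) _.
  rewrite -mulrA ler_wpM2l// -exprMn (mulrC X) lerXn2r ?nnegrE ?normc_ge0//.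
  by rewrite mulr_ge0// ltW.
have qn : normc q = (2 * k ^+ 2 * e)^-1.
  by rewrite normc_C ger0_norm// invr_ge0 !mulr_ge0// ltW.
have -> : q * (cexp x + cexp y - 2) = q * (rx + ry) + q * (x + y + (x ^+ 2 + y ^+ 2) / 2).
  by rewrite /rx /ry -mulrDr; congr (_ * _); field.
rewrite -2!addrA.
set rest := _ + (- P + _).
have restE : rest = (e ^+ 2 * (2 * k ^- 2 / 4))%:C
    * ((z * (- k ^+ 2)%:C + (- (2 * g * k ^+ 2 * b))%:C * P)
         * (z * (k - k ^+ 2 * e / 2)%:C + (b * (2 - g * e) * k ^+ 2)%:C * P)
       + (z * 0%:C + (- (2 * g * k ^+ 2 * c))%:C * P)
         * (z * (- k)%:C + (c * (2 - g * e) * k ^+ 2)%:C * P)).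
  have kC : k%:C != 0 by rewrite fmorph_eq0 gt_eqF.
  have eC : e%:C != 0 by rewrite fmorph_eq0 gt_eqF.
  have two0 : (2 : R[i]) != 0 by [].
  have E := @one_step_expansion R[i] k%:C e%:C g%:C b%:C z P kC eC two0.
  have E1 : (k * e - k ^+ 2 * e ^+ 2)%:C = k%:C * e%:C - k%:C ^+ 2 * e%:C ^+ 2.
    by rewrite rmorphB !rmorphM; ring.
  have E2 s : (s * (1 - g * e) * (2 * k ^+ 2 * e))%:C
      = s%:C * (1 - g%:C * e%:C) * (2 * k%:C ^+ 2 * e%:C).
    by rewrite !rmorphM rmorphB !rmorphM rmorph1 rmorph_nat; ring.
  have E3 : q = (2 * k%:C ^+ 2 * e%:C)^-1.
    by rewrite /q fmorphV !rmorphM rmorph_nat expr2.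
  have E4 : (k * (b - c))%:C = k%:C * (b%:C - c%:C) by rewrite rmorphM rmorphB.
  have E5 : (k ^+ 2 * (b ^+ 2 + c ^+ 2))%:C = k%:C ^+ 2 * (b%:C ^+ 2 + c%:C ^+ 2).
    by rewrite rmorphM rmorphD !rmorphM; ring.
  have E6 : c%:C = 1 - b%:C by rewrite cE rmorphB rmorph1.
  have E7 : (k * e)%:C = k%:C * e%:C by rewrite rmorphM.
  rewrite /rest addrA /x /y E1 !E2 E3 E4 E5 E6 E7 [LHS]E.
  have F1 : (e ^+ 2 * (2 * k ^- 2 / 4))%:C = e%:C ^+ 2 * (2 * k%:C ^- 2 / 4).
    by rewrite !rmorphM !fmorphV !rmorphM !rmorph_nat !expr2.
  have F2 s : (- (2 * g * k ^+ 2 * s))%:C = - (2 * g%:C * k%:C ^+ 2 * s%:C).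
    by rewrite rmorphN !rmorphM rmorph_nat; ring.
  have F3 s : (s * (2 - g * e) * k ^+ 2)%:C = s%:C * (2 - g%:C * e%:C) * k%:C ^+ 2.
    by rewrite !rmorphM rmorphB rmorphM rmorph_nat; ring.
  have F4 : (k - k ^+ 2 * e / 2)%:C = k%:C - k%:C ^+ 2 * e%:C / 2.
    by rewrite rmorphB !rmorphM fmorphV rmorph_nat expr2.
  have F5 s : (- s : R)%:C = - s%:C by rewrite rmorphN.
  have F6 : (k ^+ 2)%:C = k%:C ^+ 2 by rewrite rmorphXn.
  rewrite F1 !F2 !F3 F4 !F5 F6 E6 mulr0 add0r.
  by rewrite !mulNr !mulrN.
have restB : normc rest <= X ^+ 2 / k ^+ 2 * e ^+ 2.
  rewrite restE normcM normc_C ger0_norm; last first.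
    by rewrite mulr_ge0 ?exprn_ge0 ?(ltW e0)// divr_ge0// mulr_ge0// invr_ge0 ltW.
  have -> : X ^+ 2 / k ^+ 2 * e ^+ 2 = e ^+ 2 * (2 * k ^- 2 / 4) * (X * X + X * X).
    by field; rewrite gt_eqF.
  rewrite ler_wpM2l//.
    by rewrite mulr_ge0 ?exprn_ge0 ?(ltW e0)// divr_ge0// mulr_ge0// invr_ge0 ltW.
  have gk2 : 0 <= g * k ^+ 2 by rewrite mulr_ge0// ltW.
  have dB s : 0 <= s -> s <= 1 -> `|- (2 * g * k ^+ 2 * s)| <= 2 * k ^+ 2 * (1 + g).
    move=> s0 s1; rewrite normrN ger0_norm ?mulr_ge0 ?(ltW k0)//.
    by have : g * k ^+ 2 * s <= g * k ^+ 2; [rewrite ler_piMr|nra].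
  have sB s : 0 <= s -> s <= 1 -> `|s * (2 - g * e) * k ^+ 2| <= 2 * k ^+ 2 * (1 + g).
    move=> s0 s1; rewrite normrM [X in _ * X]ger0_norm ?(ltW k20)// mulrAC ler_pM2r//.
    rewrite normrM ger0_norm// -[leRHS]mul1r ler_pM//.
    by rewrite ler_norml; apply/andP; split; lra.
  apply: le_trans (normcD_le _ _) _; rewrite !normcM; apply: lerD; rewrite ler_pM ?normc_ge0//.
  - apply: linB; last exact: dB.
    by rewrite normrN gtr0_norm//; lra.
  - apply: linB; last exact: sB.
    by rewrite ler_norml; apply/andP; split; lra.
  - apply: linB; last exact: dB.
    by rewrite normr0; lra.
  - apply: linB; last exact: sB.
    by rewrite normrN gtr0_norm//; lra.
apply: le_trans (normcD_le _ _) _; rewrite normcM qn.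
rewrite [leRHS](_ : _ = K * X ^+ 3 / k ^+ 2 * e ^+ 2 + X ^+ 2 / k ^+ 2 * e ^+ 2); last by ring.
apply: lerD restB.
apply: le_trans (ler_wpM2l _ (le_trans (normcD_le _ _) (lerD (rB _ xB) (rB _ yB)))) _.
  by rewrite invr_ge0 !mulr_ge0// ltW.
by rewrite le_eqVlt; apply/orP; left; apply/eqP; field; rewrite !gt_eqF.
Qed.

End OneStep.

(** * Stability of renewal recursions *)

Section Gronwall.
Context {R : realType}.

(** Cut the sum at 1 / y. Before, the geometric weights are at most 1 and the powers
   sum to at most (1 / y)^a / a; after, the powers are at most y^(1 - a) and the
   weights sum to at most 1 / y. *)
Lemma weighted_sum_le (a y : R) n : 2^-1 <= a <= 1 -> 0 < y <= 1 ->
  \sum_(k < n) k.+1%:R `^ (a - 1) * (1 - y) ^+ k <= 3 * y `^ (- a).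
Proof.
move=> /andP[a12 a1] /andP[y0 y1]; have a0 : 0 < a by apply: lt_le_trans a12.
have a01 : 0 < a <= 1 by rewrite a0.
have x0 : 0 <= 1 - y by rewrite subr_ge0.
have x1 : 1 - y <= 1 by rewrite gerBl ltW.
have ya : 0 < y `^ (- a) by rewrite powR_gt0.
have iy0 : 0 < y^-1 by rewrite invr_gt0.
have invy : y^-1 `^ a = y `^ (- a) by rewrite -powR_inv1 ?(ltW y0)// -powRrM mulN1r.
pose m := Num.truncn y^-1.
have mle : m%:R <= y^-1 by rewrite truncn_le// ltW.
have mgt : y^-1 < m.+1%:R := truncnS_gt _.
have head j : (j <= m)%N -> \sum_(k < j) k.+1%:R `^ (a - 1) * (1 - y) ^+ k <= 2 * y `^ (- a).
  move=> jm; apply: (@le_trans _ _ (\sum_(k < j) k.+1%:R `^ (a - 1))).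
    by apply: ler_sum => k _; rewrite ler_piMr ?powR_ge0// exprn_ile1.
  apply: le_trans (sum_powR_le j a01) _; rewrite ler_pdivrMr// -invy.
  apply: (@le_trans _ _ (y^-1 `^ a)); last first.
    by rewrite mulrAC ler_peMl ?powR_ge0//; lra.
  by rewrite ge0_ler_powR ?(ltW a0) ?nnegrE ?(ltW iy0)// (le_trans _ mle)// ler_nat.
have [nm|mn] := leqP n m; first by apply: le_trans (head _ nm) _; lra.
rewrite -(big_mkord xpredT (fun k => k.+1%:R `^ (a - 1) * (1 - y) ^+ k)).
rewrite (@big_cat_nat _ _ _ m)//= ?(ltnW mn)//.
rewrite (_ : 3 = 2 + 1); last by ring.
rewrite mulrDl; apply: lerD; first by rewrite big_mkord head.
have geo : \sum_(0 <= k < n) (1 - y) ^+ k <= y^-1.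
  rewrite big_mkord -[leRHS]div1r ler_pdivlMr// mulrC.
  have := subrX1 (1 - y) n; rewrite (_ : 1 - y - 1 = - y); last by ring.
  have : 0 <= (1 - y) ^+ n by rewrite exprn_ge0.
  by rewrite mulNr; lra.
apply: (@le_trans _ _ (y `^ (1 - a) * \sum_(0 <= k < n) (1 - y) ^+ k)).
  rewrite [X in _ <= _ * X](@big_cat_nat _ _ _ m)//= ?(ltnW mn)// mulrDr.
  rewrite -[leLHS]add0r; apply: lerD.
    by rewrite mulr_ge0 ?powR_ge0// sumr_ge0// => k _; rewrite exprn_ge0.
  rewrite mulr_sumr; apply: ler_sum_nat => k /andP[mk _].
  rewrite ler_wpM2r ?exprn_ge0//.
  have -> : y `^ (1 - a) = y^-1 `^ (a - 1).
    by rewrite -powR_inv1 ?(ltW y0)// -powRrM mulN1r opprB.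
  apply: ler_powRB1 => //; rewrite (le_trans (ltW mgt))// ler_nat ltnS//.
apply: le_trans (ler_wpM2l (powR_ge0 _ _) geo) _.
rewrite mul1r (@powRD _ y 1 (- a)) ?(gt_eqF y0) ?implybT// powRr1 ?(ltW y0)//.
by rewrite mulrAC divff ?gt_eqF// mul1r.
Qed.

(** With the weight x^n the kernel has total mass at most 1/2, so that its
   contribution can be absorbed. The recursion is available only as long as the
   errors stay below 1, which the bound itself guarantees since 2 A <= x^N. *)
Lemma gronwall_bootstrap (u E : nat -> R) (A l x : R) N :
  (forall n, 0 <= u n) -> (forall n, 0 <= E n) -> 0 <= l -> 0 < x <= 1 ->
  2 * A <= x ^+ N ->
  (forall n, (n <= N)%N -> l * \sum_(k < n.+1) u k * x ^+ k <= 2^-1) ->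
  (forall n, (n <= N)%N -> (forall k, (k < n)%N -> E k <= 1) ->
     E n <= A + l * cauchyM u E n) ->
  forall n, (n <= N)%N -> x ^+ n * E n <= 2 * A.
Proof.
move=> u0 E0 l0 /andP[x0 x1] AN lu rec.
have A0 : 0 <= A.
  have := rec 0%N (leq0n _) (fun k h => match notF h with end).
  have := lu 0%N (leq0n _); rewrite /cauchyM !big_ord1 subnn expr0 mulr1 => h1 h2.
  have := E0 0%N; have : l * (u 0%N * E 0%N) <= 2^-1 * E 0%N by rewrite mulrA ler_wpM2r.
  by move: h2; lra.
elim/ltn_ind => n IHn nN.
have xn j : (j <= n)%N -> x ^+ N <= x ^+ j.
  by move=> jn; rewrite ler_wiXn2l ?(ltW x0)// (leq_trans jn).
have Ek k : (k < n)%N -> E k <= 1.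
  move=> kn; have h := IHn k kn (ltnW (leq_trans kn nN)).
  have xk0 : 0 < x ^+ k by rewrite exprn_gt0.
  rewrite -(ler_pM2l xk0) mulr1 (le_trans h)// (le_trans AN)// xn// ltnW//.
have h1 := rec n nN Ek; have h2 := lu n nN.
set X := x ^+ n * E n.
have xn1 : x ^+ n <= 1 by rewrite exprn_ile1// ltW.
have xn0 : 0 < x ^+ n by rewrite exprn_gt0.
set s := \sum_(k < n) u k.+1 * x ^+ k.+1.
have h3 : x ^+ n * cauchyM u E n <= u 0%N * X + s * (2 * A).
  rewrite /cauchyM mulr_sumr big_ord_recl subn0 mulrCA lerD2l /s mulr_suml.
  apply: ler_sum => -[k kn] _; rewrite /= /bump/= add1n.
  have -> : x ^+ n = x ^+ k.+1 * x ^+ (n - k.+1)%N by rewrite -exprD subnKC.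
  rewrite mulrACA mulrA -mulrA [leLHS](_ : _ = (u k.+1 * x ^+ k.+1) * (x ^+ (n - k.+1)%N * E (n - k.+1)%N)); last by ring.
  rewrite ler_wpM2l ?mulr_ge0 ?exprn_ge0 ?(ltW x0)//.
  by apply: IHn; [rewrite ltn_subrL (leq_ltn_trans _ kn)|rewrite (leq_trans (leq_subr _ _))].
move: h2; rewrite big_ord_recl expr0 mulr1 -/s mulrDr => h2.
have h4 : X <= A + l * (u 0%N * X + s * (2 * A)).
  apply: (@le_trans _ _ (x ^+ n * (A + l * cauchyM u E n))); first by rewrite ler_wpM2l// ltW.
  rewrite mulrDr mulrCA; apply: lerD; first by rewrite ler_piMl.
  by rewrite ler_wpM2l.
have lu0 : 0 <= l * u 0%N by rewrite mulr_ge0.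
have ls0 : 0 <= l * s.
  by rewrite mulr_ge0// sumr_ge0// => k _; rewrite mulr_ge0 ?exprn_ge0 ?(ltW x0).
have c0 : 0 < 1 - l * u 0%N by lra.
rewrite -(ler_pM2l c0).
have : 2 * A * (l * u 0%N + l * s) <= 2 * A * 2^-1 by rewrite ler_wpM2l// mulr_ge0.
by move: h4; rewrite !mulrDr; lra.
Qed.

End Gronwall.

Section SchemeError.
Context {R : realType}.
Implicit Types (f g : nat -> R).

Definition cseq f : nat -> R[i] := fun n => (f n)%:C.

Lemma cauchyM_cseq f g : cauchyM (cseq f) (cseq g) = cseq (cauchyM f g).
Proof.
apply/funext => n; rewrite /cseq /cauchyM rmorph_sum; apply: eq_bigr => k _.
by rewrite rmorphM.
Qed.

(** From H = u * (H - P) and h = e v * F(h) + O(e), the error H - h is the sum of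
   u * (H - P - e F(h)), of e (u - v) * F(h) and of the consistency error of h. In
   the first one, F(P) - F(h) is at most L |P - h|, and P differs from H by O(e).
   All arguments of F stay in the ball of radius M + 1 because P is an average of
   earlier values of H, which are within 1 of h. *)
Lemma scheme_error (w u v : nat -> R) (Hs hs : nat -> R[i]) (F : R[i] -> R[i])
    (M L Fb C1 C2 e x D Ub A : R) N :
  let P := cauchyM (cseq w) Hs in
  w 0%N = 0 -> (forall n, 0 <= w n) -> (forall n, \sum_(k < n.+1) w k <= 1) ->
  cauchyM u (unit_seq \- w) = unit_seq -> (forall n, 0 <= u n) ->
  0 < e <= 1 -> 0 < x <= 1 -> 0 <= M -> 0 <= L -> 0 <= Fb -> 0 <= C1 ->
  (forall p q, normc p <= M + 1 -> normc q <= M + 1 ->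
     normc (F p - F q) <= L * normc (p - q)) ->
  (forall p, normc p <= M + 1 -> normc (F p) <= Fb) ->
  (forall n, (n <= N)%N -> normc (P n) <= M + 1 ->
     normc (Hs n - P n - e%:C * F (P n)) <= C1 * e ^+ 2) ->
  (forall n, (n <= N)%N -> normc (hs n) <= M) ->
  (forall n, (n <= N)%N ->
     normc (hs n - e%:C * cauchyM (cseq v) (F \o hs) n) <= C2 * e) ->
  (forall n, (n <= N)%N -> \sum_(k < n.+1) `|u k - v k| <= D) ->
  (forall n, (n <= N)%N -> e * \sum_(k < n.+1) u k <= Ub) ->
  (forall n, (n <= N)%N -> e * L * \sum_(k < n.+1) u k * x ^+ k <= 2^-1) ->
  A = Ub * ((C1 + L * (Fb + C1)) * e) + e * D * Fb + C2 * e ->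
  2 * A <= x ^+ N ->
  forall n, (n <= N)%N -> x ^+ n * normc (Hs n - hs n) <= 2 * A.
Proof.
move=> P w0 wge wsum uw u0 /andP[e0 e1] x01 M0 L0 Fb0 C10 FL FB step hM hc hD hUb hw AE AN.
pose E n := normc (Hs n - hs n).
apply: (@gronwall_bootstrap _ u E A (e * L) x N) => //.
- by move=> n; exact: normc_ge0.
- by rewrite mulr_ge0// ltW.
move=> n nN Ek.
have eM : 0 <= e by exact: ltW.
have PB j : (j <= n)%N -> normc (P j) <= M + 1.
  move=> jn; apply: le_trans (normc_sum_le _ _ _) _.
  apply: (@le_trans _ _ (\sum_(k < j.+1) w k * (M + 1))); last first.
    by rewrite -mulr_suml ler_piMl// addr_ge0.
  apply: ler_sum => -[k kj] _ /=; rewrite normcM normc_C ger0_norm//.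
  case: k kj => [|k] kj; first by rewrite w0 !mul0r.
  rewrite ler_wpM2l//; have jk : (j - k.+1 < n)%N.
    have kj' : (k < j)%N := kj.
    by apply: leq_trans jn; rewrite ltn_subrL/= (leq_ltn_trans _ kj').
  have := Ek _ jk; rewrite /E => h.
  rewrite -[Hs _](subrK (hs (j - k.+1)%N)) (le_trans (normcD_le _ _))// addrC lerD//.
  by rewrite hM// (leq_trans (ltnW jk)).
pose f := Hs \- P.
have fE : f = cauchyM (cseq (unit_seq \- w)) Hs.
  have -> : cseq (unit_seq \- w) = unit_seq \- cseq w.
    by apply/funext => k; rewrite /cseq /= rmorphB /unit_seq rmorph_nat.
  by rewrite cauchyMBl cauchyM1l.
have HsE : Hs = cauchyM (cseq u) f.
  rewrite fE cauchyMA cauchyM_cseq uw.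
  have -> : cseq unit_seq = unit_seq by apply/funext => k; rewrite /cseq /unit_seq rmorph_nat.
  by rewrite cauchyM1l.
have fF j : (j <= n)%N -> normc (f j - e%:C * F (P j)) <= C1 * e ^+ 2.
  by move=> jn; apply: step; [exact: leq_trans nN|exact: PB].
have fB j : (j <= n)%N -> normc (f j) <= e * (Fb + C1).
  move=> jn; rewrite -[f j](subrK (e%:C * F (P j))) (le_trans (normcD_le _ _))//.
  rewrite mulrDr addrC lerD//.
    by rewrite normcM normc_C ger0_norm// ler_wpM2l// FB// PB.
  apply: le_trans (fF _ jn) _; rewrite mulrC ler_wpM2r// expr2 ler_piMr//.
have key j : (j <= n)%N -> normc (f j - e%:C * F (hs j))
    <= (C1 + L * (Fb + C1)) * e ^+ 2 + e * L * E j.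
  move=> jn; have -> : f j - e%:C * F (hs j)
    = (f j - e%:C * F (P j)) + e%:C * (F (P j) - F (hs j)) by ring.
  apply: le_trans (normcD_le _ _) _.
  rewrite [leRHS](_ : _ = C1 * e ^+ 2 + (L * (Fb + C1) * e ^+ 2 + e * L * E j)); last by ring.
  apply: lerD; first exact: fF.
  rewrite normcM normc_C ger0_norm//.
  have hj : normc (hs j) <= M by rewrite hM// (leq_trans jn).
  apply: le_trans (ler_wpM2l eM (FL _ _ (PB _ jn) (le_trans hj _))) _; first by rewrite lerDl.
  have PE : normc (P j - hs j) <= e * (Fb + C1) + E j.
    have -> : P j - hs j = - f j + (Hs j - hs j) by rewrite /f/=; ring.
    by apply: le_trans (normcD_le _ _) _; rewrite normc_opp lerD2r fB.
  apply: le_trans (ler_wpM2l eM (ler_wpM2l L0 PE)) _.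
  by rewrite le_eqVlt; apply/orP; left; apply/eqP; ring.
rewrite /E {1}HsE.
have -> : cauchyM (cseq u) f n - hs n
  = \sum_(k < n.+1) (u k)%:C * (f (n - k)%N - e%:C * F (hs (n - k)%N))
    + e%:C * \sum_(k < n.+1) (u k - v k)%:C * F (hs (n - k)%N)
    - (hs n - e%:C * cauchyM (cseq v) (F \o hs) n).
  have S1 : \sum_(k < n.+1) (u k)%:C * (f (n - k)%N - e%:C * F (hs (n - k)%N))
      = cauchyM (cseq u) f n - e%:C * \sum_(k < n.+1) (u k)%:C * F (hs (n - k)%N).
    by rewrite mulr_sumr -sumrB; apply: eq_bigr => k _; rewrite /cseq; ring.
  have S2 : \sum_(k < n.+1) (u k - v k)%:C * F (hs (n - k)%N)
      = \sum_(k < n.+1) (u k)%:C * F (hs (n - k)%N) - cauchyM (cseq v) (F \o hs) n.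
    by rewrite -sumrB; apply: eq_bigr => k _; rewrite rmorphB mulrBl.
  by rewrite S1 S2; ring.
apply: le_trans (normcB_le _ _) _.
apply: le_trans (lerD (normcD_le _ _) (hc _ nN)) _.
rewrite AE [leRHS](addrAC _ (C2 * e)) lerD2r [leRHS](addrAC _ (e * D * Fb)).
apply: lerD.
- apply: le_trans (normc_sum_le _ _ _) _.
  apply: (@le_trans _ _ (\sum_(k < n.+1) (u k * ((C1 + L * (Fb + C1)) * e ^+ 2)
      + e * L * (u k * E (n - k)%N)))).
    apply: ler_sum => k _; rewrite normcM normc_C ger0_norm//.
    apply: le_trans (ler_wpM2l (u0 k) (key _ (leq_subr _ _))) _.
    by rewrite le_eqVlt; apply/orP; left; apply/eqP; ring.
  rewrite big_split/= -mulr_suml -mulr_sumr; apply: lerD => //.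
  have c0 : 0 <= (C1 + L * (Fb + C1)) * e.
    by rewrite mulr_ge0// addr_ge0// mulr_ge0// addr_ge0.
  apply: le_trans (ler_wpM2r c0 (hUb _ nN)).
  by rewrite le_eqVlt; apply/orP; left; apply/eqP; ring.
- rewrite normcM normc_C ger0_norm// -mulrA ler_wpM2l//.
  apply: le_trans (normc_sum_le _ _ _) _.
  apply: le_trans (ler_wpM2r Fb0 (hD _ nN)); rewrite mulr_suml.
  apply: ler_sum => k _; rewrite normcM normc_C ler_wpM2l//.
  by rewrite FB// (le_trans (hM _ _)) ?lerDl// (leq_trans (leq_subr _ _)).
Qed.

End SchemeError.

(** * The scheme and its limit *)

Section Scaling.
Context {R : realType}.
Variables (p : params R) (alpha : R).
Hypothesis beta_gt1 : 1 < beta p.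
Hypothesis gamma_gt0 : 0 < gamma p.
Hypothesis mu_gt0 : 0 < mu p.
Hypothesis theta_gt0 : 0 < theta p.

Definition scale_k : R := Num.sqrt (theta p * gamma p / (2 * mu p)).
Definition weight_p : R := (1 + beta p)^-1.
Definition weight_m : R := beta p / (1 + beta p).

Local Notation k := scale_k.
Local Notation b := weight_p.
Local Notation c := weight_m.

Let beta1 : 0 < 1 + beta p. Proof. by have := beta_gt1; lra. Qed.

Lemma scale_k_gt0 : 0 < k.
Proof. by rewrite sqrtr_gt0 divr_gt0 ?mulr_gt0. Qed.

Lemma weight_p_ge0 : 0 <= b. Proof. by rewrite invr_ge0 ltW. Qed.

Lemma weight_m_ge0 : 0 <= c.
Proof. by rewrite divr_ge0 ?(ltW beta1)// (le_trans _ (ltW beta_gt1)). Qed.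

Lemma weight_sum : b + c = 1.
Proof. by rewrite /b /c; field; rewrite gt_eqF. Qed.

Let k2 : k ^+ 2 = theta p * gamma p / (2 * mu p).
Proof. by rewrite sqr_sqrtr// divr_ge0 ?mulr_ge0 ?ltW. Qed.

Let nuE : nu p = Num.sqrt (2 * (1 + beta p ^+ 2)) * (k / (gamma p * (1 + beta p))).
Proof.
have h0 : 0 <= k / (gamma p * (1 + beta p)).
  by rewrite divr_ge0 ?(ltW scale_k_gt0)// mulr_ge0// ltW.
rewrite -[X in _ = _ * X]ger0_norm// -sqrtr_sqr -sqrtrM; last first.
  by rewrite mulr_ge0// addr_ge0// sqr_ge0.
rewrite /nu; congr Num.sqrt; rewrite expr_div_n k2.
by field; rewrite !gt_eqF.
Qed.

Let rhonu : gamma p * (rho p * nu p) = k * (b - c).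
Proof.
have s0 : 0 < Num.sqrt (2 * (1 + beta p ^+ 2)).
  by rewrite sqrtr_gt0 mulr_gt0// ltr_pwDl// sqr_ge0.
rewrite nuE /rho /weight_p /weight_m; move: (Num.sqrt _) s0 => s s0.
by field; rewrite !gt_eqF.
Qed.

Let gnu2 : (gamma p * nu p) ^+ 2 / 2 = k ^+ 2 * (b ^+ 2 + c ^+ 2).
Proof.
rewrite nuE !exprMn sqr_sqrtr; last by rewrite mulr_ge0// addr_ge0// sqr_ge0.
by rewrite /weight_p /weight_m; field; rewrite !gt_eqF.
Qed.

Lemma riccati_rhsE z x : riccati_rhs p z x =
  (z ^+ 2 - z) / 2 + ((k * (b - c))%:C * z - (gamma p)%:C) * x
  + (k ^+ 2 * (b ^+ 2 + c ^+ 2))%:C * x ^+ 2.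
Proof.
rewrite /riccati_rhs gnu2 -rhonu; congr (_ + _ * _ + _).
by rewrite [in RHS]rmorphM mulrBr mulr1 mulrA.
Qed.

Variable tau : nat.
Hypothesis tau_gt0 : (0 < tau)%N.
Let e : R := tau%:R `^ (- alpha).

Let tau0 : 0 < tau%:R :> R. Proof. by rewrite ltr0n. Qed.
Let e0 : 0 < e. Proof. exact: powR_gt0. Qed.

Let eV : tau%:R `^ alpha = e^-1.
Proof. by rewrite /e powRN invrK. Qed.

Let dE : d_ p alpha tau = k ^+ 2 * e ^+ 2.
Proof. by rewrite /d_ /eps -/e eV k2; field; rewrite !gt_eqF. Qed.

Let cE : c_ p alpha tau = k * e.
Proof.
rewrite /c_ -/(d_ p alpha tau) dE -exprMn sqrtr_sqr ger0_norm// mulr_ge0 ?ltW//.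
exact: scale_k_gt0.
Qed.

Let scE : mu p / (theta p * eps p alpha tau) = (2 * k ^+ 2 * e)^-1.
Proof. by rewrite /eps -/e k2; field; rewrite !gt_eqF. Qed.

(** Both exponents involve the past through one and the same convolution, which is
   what makes the renewal sequence of phi relevant; the factor 1 - eps of the
   kernel is kept apart, as it contributes to the Riccati right-hand side. *)
Lemma H_stepE n z : let P := cauchyM (cseq (phi alpha)) (fun n => H p alpha tau n z) n in
  H p alpha tau n z = ((2 * k ^+ 2 * e)^-1)%:C
    * (cexp (z * (k * e - k ^+ 2 * e ^+ 2)%:C
             + (b * (1 - gamma p * e) * (2 * k ^+ 2 * e))%:C * P)
       + cexp (- z * (k * e)%:C
               + (c * (1 - gamma p * e) * (2 * k ^+ 2 * e))%:C * P)
       - 2).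
Proof.
move=> P; have q0 : 2 * k ^+ 2 * e != 0.
  by rewrite !mulf_neq0 ?expf_neq0 ?(gt_eqF e0) ?(gt_eqF scale_k_gt0).
have GH m : G p alpha tau m z = (2 * k ^+ 2 * e)%:C * H p alpha tau m z.
  by rewrite /H scE mulrA -rmorphM divff// mul1r.
have sumE (q : nat -> R) (s : R) : (forall j, q j = s * phi alpha j) ->
    \sum_(1 <= j < n.+1) (q j)%:C * G p alpha tau (n - j) z = (s * (2 * k ^+ 2 * e))%:C * P.
  move=> qE; rewrite /P /cauchyM big_ord_recl /cseq /= mul0r add0r big_add1 big_mkord mulr_sumr.
  by apply: eq_bigr => j _; rewrite /bump/= add1n qE GH !rmorphM; ring.
rewrite {1}/H scE G_rec (sumE (qp p alpha tau) (b * (1 - gamma p * e))); last first.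
  by move=> j; rewrite /qp /phit /a_ /eps -/e /weight_p; ring.
rewrite (sumE (qm p alpha tau) (c * (1 - gamma p * e))); last first.
  by move=> j; rewrite /qm /phit /a_ /eps -/e /weight_m; ring.
by rewrite /Thetap /Thetam cE dE.
Qed.

End Scaling.

Section Riccati.
Context {R : realType}.
Variable p : params R.
Hypothesis beta_gt1 : 1 < beta p.
Hypothesis gamma_gt0 : 0 < gamma p.
Hypothesis mu_gt0 : 0 < mu p.
Hypothesis theta_gt0 : 0 < theta p.
Implicit Types (z x y : R[i]) (Z B : R).

Let lin Z : R := `|scale_k p * (weight_p p - weight_m p)| * Z + gamma p.
Let quad : R := scale_k p ^+ 2 * (weight_p p ^+ 2 + weight_m p ^+ 2).

Let quad0 : 0 <= quad.
Proof. by rewrite mulr_ge0 ?addr_ge0 ?sqr_ge0. Qed.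

Definition riccati_lip Z B : R := lin Z + quad * (2 * B).
Definition riccati_sup Z B : R := (Z ^+ 2 + Z) / 2 + lin Z * B + quad * B ^+ 2.

Let lin0 Z : 0 <= Z -> 0 <= lin Z.
Proof. by move=> Z0; rewrite addr_ge0 ?mulr_ge0// ltW. Qed.

Lemma riccati_lip_ge0 Z B : 0 <= Z -> 0 <= B -> 0 <= riccati_lip Z B.
Proof. by move=> Z0 B0; apply: addr_ge0; [exact: lin0|apply: mulr_ge0 => //; exact: mulr_ge0]. Qed.

Lemma riccati_sup_ge0 Z B : 0 <= Z -> 0 <= B -> 0 <= riccati_sup Z B.
Proof.
move=> Z0 B0; apply: addr_ge0; last by rewrite mulr_ge0 ?exprn_ge0.
by rewrite addr_ge0 ?mulr_ge0 ?lin0// addr_ge0 ?exprn_ge0.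
Qed.

Let linB Z z : normc z <= Z ->
  normc ((scale_k p * (weight_p p - weight_m p))%:C * z - (gamma p)%:C) <= lin Z.
Proof.
move=> zZ; apply: le_trans (normcB_le _ _) _; rewrite normcM !normc_C.
by rewrite (gtr0_norm gamma_gt0) lerD2r ler_wpM2l.
Qed.

Lemma riccati_lipP Z B z x y : normc z <= Z -> normc x <= B -> normc y <= B ->
  normc (riccati_rhs p z x - riccati_rhs p z y) <= riccati_lip Z B * normc (x - y).
Proof.
move=> zZ xB yB; rewrite !riccati_rhsE//.
set l := (_%:C * z - _); set s := (_ ^+ 2 * _)%:C.
rewrite [X in normc X](_ : _ = (l + s * (x + y)) * (x - y)); last by ring.
rewrite normcM ler_wpM2r ?normc_ge0// (le_trans (normcD_le _ _))// lerD ?linB//.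
rewrite normcM normc_C ger0_norm// ler_wpM2l// (le_trans (normcD_le _ _))//.
by rewrite mulr_natl mulr2n lerD.
Qed.

Lemma riccati_supP Z B z x : normc z <= Z -> normc x <= B ->
  normc (riccati_rhs p z x) <= riccati_sup Z B.
Proof.
move=> zZ xB; rewrite riccati_rhsE//.
have Z0 : 0 <= Z := le_trans (normc_ge0 _) zZ.
apply: le_trans (normcD_le _ _) _; apply: lerD; last first.
  rewrite normcM normc_C ger0_norm// ler_wpM2l// normcX.
  by rewrite lerXn2r ?nnegrE ?normc_ge0// (le_trans (normc_ge0 _) xB).
apply: le_trans (normcD_le _ _) _; apply: lerD; last first.
  by rewrite normcM ler_pM ?normc_ge0 ?linB.
rewrite normcM (_ : (2 : R[i])^-1 = (2^-1 : R)%:C); last by rewrite fmorphV rmorph_nat.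
rewrite normc_C ger0_norm// ler_wpM2r//.
apply: le_trans (normcB_le _ _) _; rewrite normcX lerD//.
by rewrite lerXn2r ?nnegrE ?normc_ge0.
Qed.

End Riccati.

Section Consistency.
Context {R : realType}.
Notation mu := (@lebesgue_measure R).

(** The kernel being real, [volterra_hoelder] and [volterra_binser] apply to the
   real and imaginary parts; the Hoelder continuity of h passes to the Riccati
   right-hand side along h by the Lipschitz bound. *)
Lemma riccati_consistent (p : params R) (a L B M : R) (z : R[i]) (h : R -> R[i]) :
  0 < a <= 1 -> 0 < horizon p -> 0 <= L -> 0 <= B ->
  riccati_solution p a z h ->
  (forall t, 0 <= t <= horizon p -> normc (riccati_rhs p z (h t)) <= B) ->
  (forall s t, 0 <= s <= horizon p -> 0 <= t <= horizon p ->
     normc (riccati_rhs p z (h s) - riccati_rhs p z (h t)) <= L * normc (h s - h t)) ->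
  forall (dt : R) n, 0 < dt -> n%:R * dt <= horizon p ->
  normc (h (n%:R * dt) - (dt `^ a)%:C
         * cauchyM (cseq (binser a)) (fun k => riccati_rhs p z (h (k%:R * dt))) n)
  <= 2 * (L * (4 * B / (a * Gamma a)) * (horizon p `^ a / (a * Gamma a))
          + B * ((a * Gamma a)^-1 + 2 + (Gamma a)^-1)) * dt `^ a.
Proof.
move=> a01 T0 L0 B0 sol gB gL dt n dt0 nT.
have a0 : 0 < a by case/andP: a01.
have G0 : 0 < Gamma a by exact: Gamma_gt0.
pose g t := riccati_rhs p z (h t).
have ReM (s : R) (w : R[i]) : Re (s%:C * w) = s * Re w.
  by case: w => u v /=; rewrite mul0r subr0.
have ImM (s : R) (w : R[i]) : Im (s%:C * w) = s * Im w.
  by case: w => u v /=; rewrite mul0r addr0.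
have ReS m : Re (cauchyM (cseq (binser a)) (fun k => g (k%:R * dt)) m)
    = cauchyM (binser a) (fun k => Re (g (k%:R * dt))) m.
  rewrite /cauchyM /cseq; elim/big_rec2: _ => // i u v _ <-.
  by rewrite -ReM; case: (_ * _) => ? ?; case: (v) => ? ?.
have ImS m : Im (cauchyM (cseq (binser a)) (fun k => g (k%:R * dt)) m)
    = cauchyM (binser a) (fun k => Im (g (k%:R * dt))) m.
  rewrite /cauchyM /cseq; elim/big_rec2: _ => // i u v _ <-.
  by rewrite -ImM; case: (_ * _) => ? ?; case: (v) => ? ?.
have iRe t : 0 <= t <= horizon p ->
    mu.-integrable `[0, t] (EFin \o (fun s => (t - s) `^ (a - 1) * Re (g s))).
  move=> /sol[[i1 _] _]; apply: eq_integrable_in i1; first exact: measurable_itv.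
  by move=> s _; exact: ReM.
have iIm t : 0 <= t <= horizon p ->
    mu.-integrable `[0, t] (EFin \o (fun s => (t - s) `^ (a - 1) * Im (g s))).
  move=> /sol[[_ i1] _]; apply: eq_integrable_in i1; first exact: measurable_itv.
  by move=> s _; exact: ImM.
have eRe t : 0 <= t <= horizon p -> Re (h t)
    = (Gamma a)^-1 * \int[mu]_(s in `[0, t]) ((t - s) `^ (a - 1) * Re (g s)).
  move=> /sol[_ ->]; rewrite ReM; congr (_ * _) => /=.
  by apply: eq_Rintegral => s _; rewrite ReM.
have eIm t : 0 <= t <= horizon p -> Im (h t)
    = (Gamma a)^-1 * \int[mu]_(s in `[0, t]) ((t - s) `^ (a - 1) * Im (g s)).
  move=> /sol[_ ->]; rewrite ImM; congr (_ * _) => /=.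
  by apply: eq_Rintegral => s _; rewrite ImM.
have bRe s : 0 <= s <= horizon p -> `|Re (g s)| <= B.
  by move=> sT; apply: le_trans (normc_Re _) (gB _ sT).
have bIm s : 0 <= s <= horizon p -> `|Im (g s)| <= B.
  by move=> sT; apply: le_trans (normc_Im _) (gB _ sT).
pose Lg := L * (4 * B / (a * Gamma a)).
have Lg0 : 0 <= Lg by rewrite mulr_ge0// divr_ge0 ?mulr_ge0// ltW.
have gh s t : 0 <= s -> s <= t -> t <= horizon p ->
    normc (g t - g s) <= Lg * (t - s) `^ a.
  move=> s0 st tT; have sT := le_trans st tT; have t0 := le_trans s0 st.
  apply: le_trans (gL _ _ _ _) _; rewrite ?t0 ?s0//.
  rewrite /Lg -mulrA ler_wpM2l//.
  have h1 := volterra_hoelder a01 iRe eRe bRe s0 st tT.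
  have h2 := volterra_hoelder a01 iIm eIm bIm s0 st tT.
  apply: le_trans (normc_le_ReIm _) _.
  have -> : Re (h t - h s) = Re (h t) - Re (h s) by case: (h t) (h s) => ? ? [].
  have -> : Im (h t - h s) = Im (h t) - Im (h s) by case: (h t) (h s) => ? ? [].
  by apply: le_trans (lerD h1 h2) _; rewrite le_eqVlt; apply/orP; left; apply/eqP; ring.
have ghRe s t : 0 <= s -> s <= t -> t <= horizon p -> `|Re (g t) - Re (g s)| <= Lg * (t - s) `^ a.
  move=> s0 st tT; apply: le_trans (gh s t s0 st tT); apply: le_trans (normc_Re _).
  by case: (g t) (g s) => ? ? [].
have ghIm s t : 0 <= s -> s <= t -> t <= horizon p -> `|Im (g t) - Im (g s)| <= Lg * (t - s) `^ a.
  move=> s0 st tT; apply: le_trans (gh s t s0 st tT); apply: le_trans (normc_Im _).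
  by case: (g t) (g s) => ? ? [].
have k1 := volterra_binser a01 iRe eRe bRe ghRe Lg0 dt0 nT.
have k2 := volterra_binser a01 iIm eIm bIm ghIm Lg0 dt0 nT.
apply: le_trans (normc_le_ReIm _) _; rewrite -/g.
set S := cauchyM (cseq _) _ _ in ReS ImS *.
have -> : Re (h (n%:R * dt) - (dt `^ a)%:C * S) = Re (h (n%:R * dt)) - dt `^ a * Re S.
  by rewrite -ReM; case: (h _) (_ * S) => ? ? [].
have -> : Im (h (n%:R * dt) - (dt `^ a)%:C * S) = Im (h (n%:R * dt)) - dt `^ a * Im S.
  by rewrite -ImM; case: (h _) (_ * S) => ? ? [].
rewrite /S ReS ImS; apply: le_trans (lerD k1 k2) _.
by rewrite le_eqVlt; apply/orP; left; apply/eqP; rewrite -/Lg; ring.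
Qed.

End Consistency.

(** * The convergence rate *)

Section FewSteps.
Context {R : realType}.
Variables (p : params R) (alpha Z : R).

Lemma G_bounded tau n : exists2 B : R, 0 <= B & forall m z,
  (m < n)%N -> normc z <= Z -> normc (G p alpha tau m z) <= B.
Proof.
elim: n => [|n [B B0 IHn]]; first by exists 0.
pose E (q : nat -> R) (s : R) : R := expR (Z * `|s| + \sum_(1 <= k < n.+1) `|q k| * B).
have cexpB (q : nat -> R) (s : R) z t : normc z <= Z -> normc t = normc z ->
    normc (cexp (t * s%:C + \sum_(1 <= k < n.+1) (q k)%:C * G p alpha tau (n - k) z)) <= E q s.
  move=> zZ tz; rewrite normc_cexp ler_expR.
  apply: le_trans (ler_norm _) _; apply: le_trans (normc_Re _) _.
  apply: le_trans (normcD_le _ _) _; rewrite normcM normc_C tz lerD ?ler_wpM2r//.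
  apply: le_trans (normc_sum_le _ _ _) _; rewrite big_nat_cond [leRHS]big_nat_cond.
  apply: ler_sum => k /andP[/andP[k1 kn] _]; rewrite normcM normc_C ler_wpM2l//.
  by apply: IHn => //; rewrite ltn_subrL k1 (leq_trans k1)// -ltnS.
pose B' := E (qp p alpha tau) (c_ p alpha tau - d_ p alpha tau)
  + E (qm p alpha tau) (c_ p alpha tau) + 2.
have B'0 : 0 <= B' by rewrite !addr_ge0 ?expR_ge0.
exists (B + B') => [|m z]; first exact: addr_ge0.
rewrite ltnS leq_eqVlt => /predU1P[->|mn] zZ; last first.
  by rewrite (le_trans (IHn _ _ mn zZ))// lerDl.
apply: (@le_trans _ _ B'); last by rewrite lerDr.
rewrite G_rec; apply: le_trans (normcB_le _ _) _; apply: lerD; last first.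
  by rewrite -[2]/(2%:R) -(rmorph_nat (real_complex R)) normc_C ger0_norm.
apply: le_trans (normcD_le _ _) _; apply: lerD; rewrite /Thetap /Thetam cexpB//.
by rewrite normc_opp.
Qed.

(** This crude bound serves for the finitely many tau to which the asymptotic
   estimate does not apply. *)
Lemma H_bounded_below tau0 : exists2 B : R, 0 <= B & forall tau n z,
  (tau < tau0)%N -> (n <= N_ p tau)%N -> normc z <= Z -> normc (H p alpha tau n z) <= B.
Proof.
elim: tau0 => [|t [B B0 IHt]]; first by exists 0.
have [B' B'0 hB'] := G_bounded t (N_ p t).+1.
pose s := `|mu p / (theta p * eps p alpha t)|.
have s0 : 0 <= s by exact: normr_ge0.
exists (B + s * B') => [|tau n z]; first by apply: addr_ge0 => //; exact: mulr_ge0.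
rewrite ltnS leq_eqVlt => /predU1P[->|taut] nN zZ; last first.
  by rewrite (le_trans (IHt _ _ _ taut nN zZ))// lerDl mulr_ge0.
apply: (@le_trans _ _ (s * B')); last by rewrite lerDr.
by rewrite /H normcM normc_C ler_wpM2l// hB'.
Qed.

End FewSteps.

Section LargeTau.
Context {R : realType}.

Lemma powR_small (c B : R) : 0 < c ->
  exists n0, forall n, (n0 <= n)%N -> B * n%:R `^ (- c) <= 1.
Proof.
move=> c0; exists (Num.truncn (`|B| `^ c^-1)).+1 => n nn.
have h : `|B| `^ c^-1 < n%:R.
  by apply: lt_le_trans (truncnS_gt _) _; rewrite ler_nat.
have n0 : 0 < n%:R :> R by apply: le_lt_trans h; exact: powR_ge0.
rewrite powRN ler_pdivrMr ?powR_gt0// mul1r (le_trans (ler_norm _))//.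
have -> : `|B| = (`|B| `^ c^-1) `^ c by rewrite -powRrM mulVf ?gt_eqF// powRr1.
by rewrite ge0_ler_powR ?(ltW c0) ?nnegrE ?powR_ge0 ?(ltW n0) ?(ltW h).
Qed.

Lemma expR_le_onem (y : R) : 0 <= y <= 2^-1 -> expR (- (2 * y)) <= 1 - y.
Proof.
move=> /andP[y0 y2]; rewrite expRN.
have h := expR_ge1Dx (2 * y).
have h1 : 0 < 1 + 2 * y by lra.
apply: (@le_trans _ _ (1 + 2 * y)^-1).
  by rewrite lef_pV2 ?posrE ?expR_gt0.
rewrite -[leLHS]mul1r ler_pdivrMr//; nra.
Qed.

Variable p : params R.
Hypothesis beta_gt1 : 1 < beta p.
Hypothesis gamma_gt0 : 0 < gamma p.
Hypothesis mu_gt0 : 0 < mu p.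
Hypothesis theta_gt0 : 0 < theta p.
Hypothesis T_gt0 : 0 < horizon p.
Variables (Z M : R).
Hypotheses (Z0 : 0 <= Z) (M0 : 0 <= M).

Local Notation T := (horizon p).
Let L := riccati_lip p Z (M + 1).
Let Fb := riccati_sup p Z (M + 1).
(* This makes 3 L / sigma^alpha, the bound of the weighted kernel, at most 1/2
   for all alpha >= 1/2 at once. *)
Let sigma : R := 1 + (6 * L) ^+ 2.

Definition growth_constant : R := expR (2 * sigma * T).
Local Notation W := growth_constant.

(** The second factor comes from the l^1 distance of [renewal_ex] on O(tau) steps,
   where T + 1 accounts for the number of steps, times the bound of the Riccati
   right-hand side. The amplification is uniform in a, hence the limit is 0. *)
Definition memory_constant (a : R) : R :=
  2 * W * (2 * ((1 - a) `^ 2^-1) / (2 * a - 1) * (T + 1) * Fb).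

Lemma memory_constant_ge0 a : 2^-1 < a < 1 -> 0 <= memory_constant a.
Proof.
move=> /andP[a12 a1]; have M10 : 0 <= M + 1 by rewrite addr_ge0.
have h : 0 < 2 * a - 1 by lra.
have Fb0 : 0 <= Fb by exact: riccati_sup_ge0.
have k0 : 0 <= 2 * (1 - a) `^ 2^-1 / (2 * a - 1).
  by rewrite divr_ge0 ?(ltW h)// mulr_ge0 ?powR_ge0.
rewrite /memory_constant; apply: mulr_ge0; first by rewrite mulr_ge0// expR_ge0.
by apply: mulr_ge0 => //; apply: mulr_ge0 => //; rewrite addr_ge0// ltW.
Qed.

Lemma memory_constant_cvg0 : memory_constant a @[a --> (1 : R)^'-] --> (0 : R).
Proof.
have h1 : (1 - a) `^ 2^-1 @[a --> (1 : R)^'-] --> (0 : R).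
  have := @powR_subl_cvg_at_left R 2^-1 1 1; rewrite subrr powR0//.
  by apply.
have h2 : (2 * a - 1)^-1 @[a --> (1 : R)^'-] --> (2 * 1 - 1 : R)^-1.
  apply: cvgV.
    by have -> : 2 * 1 - 1 = 1 :> R by ring; exact: oner_neq0.
  apply: cvg_at_left_filter; apply: cvgB; last exact: cvg_cst.
  by apply: cvgMr; exact: cvg_id.
have -> : (0 : R) = 2 * W * (2 * 0 * (2 * 1 - 1)^-1 * (T + 1) * Fb) by rewrite mulr0 !mul0r mulr0.
by apply: cvgMr; do 2!apply: cvgMl; apply: cvgM => //; apply: cvgMr.
Qed.

(** Here tau has to be large for three reasons: the exponents are at most 1, the
   weight 1 - sigma / tau is at least 1/2, and the final error is below 1, as
   [scheme_error] demands. *)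
Lemma rate_large_tau alpha : 2^-1 < alpha < 1 ->
  exists C tau0, [/\ 0 <= C, (0 < tau0)%N & forall (h : R -> R[i]) z tau n,
    normc z <= Z -> riccati_solution p alpha z h ->
    (forall t, 0 <= t <= T -> normc (h t) <= M) ->
    (tau0 <= tau)%N -> (n <= N_ p tau)%N ->
    normc (H p alpha tau n z - h (t_ tau n))
      <= C * tau%:R `^ (- alpha) + memory_constant alpha * tau%:R `^ (- (1 - alpha))].
Proof.
move=> a_bound; have /andP[a12 a1] := a_bound.
have a0 : 0 < alpha by lra.
have a01 : 0 < alpha <= 1 by rewrite a0 ltW.
have M10 : 0 <= M + 1 by rewrite addr_ge0.
have L0 : 0 <= L by exact: riccati_lip_ge0.
have Fb0 : 0 <= Fb by exact: riccati_sup_ge0.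
have T0 := ltW T_gt0.
have [u [uw u0 ule uv]] := renewal_ex a_bound.
have [C1 [X [C10 X0 step]]] := one_step (scale_k_gt0 gamma_gt0 mu_gt0 theta_gt0)
  (ltW gamma_gt0) (weight_p_ge0 beta_gt1) (weight_m_ge0 beta_gt1) (weight_sum beta_gt1) Z0 M10.
have G0 : 0 < Gamma alpha by exact: Gamma_gt0.
pose C2 := 2 * (L * (4 * Fb / (alpha * Gamma alpha)) * (T `^ alpha / (alpha * Gamma alpha))
          + Fb * ((alpha * Gamma alpha)^-1 + 2 + (Gamma alpha)^-1)).
have C20 : 0 <= C2.
  have i1 : 0 <= (alpha * Gamma alpha)^-1 by rewrite invr_ge0 mulr_ge0 ?ltW.
  have i2 : 0 <= (Gamma alpha)^-1 by rewrite invr_ge0 ltW.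
  apply: mulr_ge0 => //; apply: addr_ge0; last by apply: mulr_ge0 => //; rewrite !addr_ge0.
  apply: mulr_ge0; last by apply: mulr_ge0 => //; exact: powR_ge0.
  by apply: mulr_ge0 => //; apply: mulr_ge0 => //; exact: mulr_ge0.
pose a1c := 2 * (T + 1) * (C1 + L * (Fb + C1)) + C2.
pose a2c := 2 * ((1 - alpha) `^ 2^-1) / (2 * alpha - 1) * (T + 1) * Fb.
have al0 : 0 < 2 * alpha - 1 by lra.
have T10 : 0 <= T + 1 by rewrite addr_ge0.
have a1c0 : 0 <= a1c.
  apply: addr_ge0 => //; apply: mulr_ge0; first exact: mulr_ge0.
  by apply: addr_ge0 => //; apply: mulr_ge0 => //; exact: addr_ge0.
have k0 : 0 <= 2 * (1 - alpha) `^ 2^-1 / (2 * alpha - 1).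
  by rewrite divr_ge0 ?(ltW al0)// mulr_ge0 ?powR_ge0.
have a2c0 : 0 <= a2c by apply: mulr_ge0 => //; exact: mulr_ge0.
have W0 : 0 < W by exact: expR_gt0.
have b0 : 0 < 1 - alpha by lra.
have [n1 hn1] := @powR_small (1 - alpha) (2 * W * (a1c + a2c)) b0.
have [n2 hn2] := @powR_small alpha X a0.
have sg1 : 1 <= sigma by rewrite lerDl sqr_ge0.
have sg0 : 0 < sigma by exact: lt_le_trans sg1.
pose n3 := (Num.truncn (2 * sigma)).+1.
exists (2 * W * a1c), (n1 + n2 + n3)%N; split.
- by apply: mulr_ge0 => //; rewrite mulr_ge0 ?(ltW W0).
- by rewrite addnS.
move=> h z tau n zZ sol hM tau0 nN.
have tn1 : (n1 <= tau)%N by apply: leq_trans tau0; rewrite -addnA leq_addr.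
have tn2 : (n2 <= tau)%N by apply: leq_trans tau0; rewrite addnAC leq_addl.
have tn3 : (n3 <= tau)%N by apply: leq_trans tau0; rewrite leq_addl.
have tg0 : (0 < tau)%N by exact: leq_trans tn3.
have t0 : 0 < tau%:R :> R by rewrite ltr0n.
have t1 : 1 <= tau%:R :> R by rewrite ler1n.
have ts : 2 * sigma <= tau%:R.
  by apply: le_trans (ltW (truncnS_gt _)) _; rewrite ler_nat.
set e := tau%:R `^ (- alpha); set e' := tau%:R `^ (- (1 - alpha)).
have e0 : 0 < e by exact: powR_gt0.
have ee' : e <= e' by apply: ler_powR => //; lra.
have e1 : e <= 1.
  by have := ler_powR t1 (_ : - alpha <= 0); rewrite powRr0; apply; lra.
have e'0 : 0 < e' by exact: powR_gt0.
have eX : e * X <= 1 by rewrite mulrC hn2.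
pose dt : R := tau%:R^-1.
have dt0 : 0 < dt by rewrite invr_gt0.
have dtE : dt `^ alpha = e by rewrite /dt -powR_inv1 ?(ltW t0)// -powRrM mulN1r.
have NT j : (j <= N_ p tau)%N -> j%:R * dt <= T.
  move=> jN; rewrite ler_pdivrMr// mulrC; apply: le_trans (_ : (N_ p tau)%:R <= _).
    by rewrite ler_nat.
  by rewrite truncn_le// mulr_ge0// ltW.
have jT j : (j <= N_ p tau)%N -> 0 <= j%:R * dt <= T.
  by move=> jN; rewrite NT// mulr_ge0// ltW.
have SN j : (j <= N_ p tau)%N -> j.+1%:R <= (T + 1) * tau%:R.
  move=> jN; rewrite -natr1 mulrDl mul1r lerD//.
  by rewrite -ler_pdivrMr// NT.
pose F := riccati_rhs p z.
pose x : R := 1 - sigma / tau%:R.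
have y0 : 0 < sigma / tau%:R by rewrite divr_gt0.
have y2 : sigma / tau%:R <= 2^-1 by rewrite ler_pdivrMr//; lra.
have x0 : 0 < x by rewrite /x; lra.
(* The weight lost over the whole time interval is at most the growth constant. *)
have xNW j : (j <= N_ p tau)%N -> W^-1 <= x ^+ j.
  move=> jN; have h1 : expR (- (2 * (sigma / tau%:R))) <= x by rewrite expR_le_onem// y2 ltW.
  apply: (@le_trans _ _ (expR (- (2 * (sigma / tau%:R))) ^+ j)); last first.
    by rewrite lerXn2r ?nnegrE ?expR_ge0 ?(ltW x0).
  rewrite -expRM_natl /growth_constant -expRN ler_expR mulrN lerN2.
  rewrite [leLHS](_ : _ = 2 * sigma * (j%:R * dt)); last by rewrite /dt; ring.
  by rewrite ler_wpM2l ?NT// mulr_ge0// ltW.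
have hMj j : (j <= N_ p tau)%N -> normc (h (t_ tau j)) <= M.
  by move=> jN; rewrite hM// /t_ jT.
have A2 : 2 * (a1c * e + a2c * e') <= x ^+ N_ p tau.
  apply: le_trans (xNW _ (leqnn _)); rewrite -[leRHS]mul1r ler_pdivlMr//.
  apply: le_trans (hn1 _ tn1); rewrite -/e'.
  rewrite [leRHS](_ : _ = 2 * (a1c * e' + a2c * e') * W); last by ring.
  by rewrite ler_wpM2r ?(ltW W0)// ler_wpM2l// lerD2r ler_wpM2l.
suff : x ^+ n * normc (H p alpha tau n z - h (t_ tau n)) <= 2 * (a1c * e + a2c * e').
  move=> hx; have xn0 : 0 < x ^+ n by rewrite exprn_gt0.
  have Wx : 1 <= W * x ^+ n.
    by rewrite mulrC -ler_pdivrMr// div1r xNW.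
  have -> : 2 * W * a1c * e + memory_constant alpha * e' = W * (2 * (a1c * e + a2c * e')).
    by rewrite /memory_constant -/a2c; ring.
  apply: le_trans (ler_wpM2l (ltW W0) hx); rewrite mulrA ler_peMl ?normc_ge0//.
apply: (@scheme_error _ (phi alpha) u (binser alpha) (fun n => H p alpha tau n z) (fun n => h (t_ tau n)) F
  M L Fb C1 C2 e x (2 * (1 - alpha) `^ 2^-1 / (2 * alpha - 1) * ((T + 1) * tau%:R `^ (2 * alpha - 1)))
  (2 * (T + 1)) (a1c * e + a2c * e') (N_ p tau)) => //.
- exact: phi_ge0.
- exact: sum_phi_le1.
- by rewrite e0.
- by rewrite x0 gerBl ltW.
- by move=> *; exact: riccati_lipP.
- by move=> *; exact: riccati_supP.
- move=> j jN PB.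
  have := step e z _ _ eX zZ PB; rewrite e0 e1 => /(_ isT).
  by rewrite /F riccati_rhsE// {1}H_stepE.
- move=> j jN.
  have := @riccati_consistent _ p alpha L Fb M z h a01 T_gt0 L0 Fb0 sol _ _ dt j dt0 (NT _ jN).
  rewrite dtE -/C2; apply.
  + by move=> t tT; apply: riccati_supP => //; rewrite (le_trans (hM _ tT))// lerDl.
  + move=> s t sT tT; apply: riccati_lipP => //.
      by rewrite (le_trans (hM _ sT))// lerDl.
    by rewrite (le_trans (hM _ tT))// lerDl.
- move=> j jN; apply: le_trans (uv j) _; rewrite ler_wpM2l//.
  apply: (@le_trans _ _ (((T + 1) * tau%:R) `^ (2 * alpha - 1))).
    by rewrite ge0_ler_powR ?(ltW al0) ?nnegrE ?SN// mulr_ge0 ?(ltW t0).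
  rewrite powRM ?(ltW t0)// ler_wpM2r ?powR_ge0//.
  by apply: ler1_powR; [rewrite lerDr|lra].
- move=> j jN; apply: (@le_trans _ _ (e * (((T + 1) * tau%:R) `^ alpha / alpha))).
    rewrite ler_wpM2l ?(ltW e0)//.
    apply: (@le_trans _ _ (\sum_(k < j.+1) k.+1%:R `^ (alpha - 1))).
      by apply: ler_sum => k _; exact: ule.
    apply: le_trans (sum_powR_le j.+1 a01) _; rewrite ler_wpM2r ?invr_ge0 ?(ltW a0)//.
    by rewrite ge0_ler_powR ?(ltW a0) ?nnegrE ?SN// mulr_ge0 ?(ltW t0).
  rewrite powRM ?(ltW t0)//.
  rewrite [leLHS](_ : _ = (T + 1) `^ alpha * (e * tau%:R `^ alpha) / alpha); last by ring.
  rewrite /e powRN mulVf ?gt_eqF ?powR_gt0// mulr1 ler_pdivrMr//.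
  apply: le_trans (ler1_powR _ (ltW a1)) _; first by rewrite lerDr.
  by rewrite mulrAC ler_peMl ?addr_ge0//; lra.
- move=> j jN; rewrite -mulrA.
  have y01 : 0 < sigma / tau%:R <= 1 by rewrite y0; lra.
  have a121 : 2^-1 <= alpha <= 1 by lra.
  have hw := @weighted_sum_le R alpha _ j.+1 a121 y01.
  apply: (@le_trans _ _ (e * (L * (3 * (sigma / tau%:R) `^ (- alpha))))).
    rewrite ler_wpM2l ?(ltW e0)// ler_wpM2l// (le_trans _ hw)//.
    by apply: ler_sum => k _; rewrite ler_wpM2r ?exprn_ge0 ?(ltW x0).
  have -> : (sigma / tau%:R) `^ (- alpha) = (sigma `^ alpha)^-1 * e^-1.
    rewrite powRM ?invr_ge0 ?(ltW sg0) ?(ltW t0)// powRN; congr (_ * _).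
    by rewrite powRN -/dt dtE.
  have s6 : 6 * L <= sigma `^ alpha.
    apply: (@le_trans _ _ (sigma `^ 2^-1)); last by apply: ler_powR => //; exact: ltW.
    rewrite powR12_sqrt ?(ltW sg0)// -[leLHS]ger0_norm ?mulr_ge0//.
    by rewrite -sqrtr_sqr ler_sqrt ?(ltW sg0)// lerDr.
  have sa0 : 0 < sigma `^ alpha by rewrite powR_gt0.
  rewrite [leLHS](_ : _ = 3 * L / sigma `^ alpha); last by field; rewrite !gt_eqF.
  by rewrite ler_pdivrMr//; lra.
- rewrite /a1c /a2c.
  have -> : e' = e * tau%:R `^ (2 * alpha - 1).
    rewrite /e /e' -(@powRD _ _ (- alpha)) ?(gt_eqF t0) ?implybT//.
    by congr (_ `^ _); ring.
  ring.
Qed.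

End LargeTau.

Theorem proposition3p12 (R : realType) (p : params R)
  (beta_gt1 : 1 < beta p) (gamma_gt0 : 0 < gamma p) (mu_gt0 : 0 < mu p)
  (xi0_gt0 : 0 < xi0 p) (theta_gt0 : 0 < theta p) (T_gt0 : 0 < horizon p)
  (eta r M : R) (r_gt0 : 0 < r) :
  exists CRic : R -> R,
    (forall alpha, 2^-1 < alpha < 1 -> 0 <= CRic alpha) /\
    CRic alpha @[alpha --> (1 : R)^'-] --> (0 : R) /\
    forall alpha, 2^-1 < alpha < 1 ->
    exists2 C : R, 0 < C &
      forall (d : measure_display) (Om : measurableType d)
        (P : probability Om R) (F : R -> set (set Om))
        (WX WV V : R -> Om -> R) (PT : Om -> R)
        (d' : nat -> measure_display)
        (Om' : forall tau, measurableType (d' tau))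
        (P' : forall tau, probability (Om' tau) R)
        (Xp Xm : forall tau, nat -> Om' tau -> nat)
        (h : R -> R[i] -> R[i]) (lo hi : \bar R),
      rough_heston p alpha P F WX WV V PT ->
      (forall tau, 0 < a_ p alpha tau < 1 ->
         poisson_count_process p alpha (P' tau) tau (Xp tau) (Xm tau)) ->
      (forall z, segment eta r z ->
         riccati_solution p alpha z (fun t => h t z)) ->
      (lo < hi)%E ->
      admissible_strip p alpha P PT P' Xp Xm (strip lo hi) ->
      segment eta r `<=` strip lo hi ->
      (forall z t, segment eta r z -> 0 <= t <= horizon p ->
         normc (h t z) <= M) ->
      forall tau, 0 < a_ p alpha tau < 1 ->
      forall n z, (n <= N_ p tau)%N -> segment eta r z ->
        normc (H p alpha tau n z - h (t_ tau n) z)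
          <= C * tau%:R `^ (- alpha) + CRic alpha * tau%:R `^ (- (1 - alpha)).
Proof.
pose Z := `|eta| + r; pose M' := `|M|.
have Z0 : 0 <= Z by rewrite addr_ge0// ltW.
have segZ z : segment eta r z -> normc z <= Z.
  by move=> [zre zim]; apply: le_trans (normc_le_ReIm _) _; rewrite zre lerD2l.
have M'0 : 0 <= M' by exact: normr_ge0.
exists (memory_constant p Z M'); split=> [alpha ab|].
  exact: memory_constant_ge0.
split=> [|alpha ab]; first exact: memory_constant_cvg0.
have [C [tau0 [C0 tau00 rate]]] :=
  rate_large_tau beta_gt1 gamma_gt0 mu_gt0 theta_gt0 T_gt0 Z0 M'0 ab.
have [B B0 below] := H_bounded_below p alpha Z tau0.
have BM0 : 0 <= B + M' by exact: addr_ge0.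
have a0 : 0 < alpha by case/andP: ab => h _; apply: lt_trans h.
(* The middle term exceeds B + M' after multiplication by tau^(- alpha), for
   all tau < tau0. *)
exists (C + (B + M') * tau0%:R `^ alpha + 1).
  by rewrite ltr_wpDl// addr_ge0// mulr_ge0// powR_ge0.
move=> d Om P F WX WV V PT d' Om' P' Xp Xm h lo hi _ _ sol _ _ _ hM tau atau n z nN zseg.
have zZ := segZ _ zseg.
have hM' t : 0 <= t <= horizon p -> normc (h t z) <= M'.
  by move=> tT; apply: le_trans (hM z t zseg tT) (ler_norm _).
have mc0 : 0 <= memory_constant p Z M' alpha by exact: memory_constant_ge0.
have [ttau|taut] := leqP tau0 tau.
  apply: le_trans (rate _ _ _ _ zZ (sol z zseg) hM' ttau nN) _.
  rewrite lerD2r ler_wpM2r ?powR_ge0// -addrA lerDl addr_ge0// mulr_ge0// powR_ge0.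
have tau_gt0 : (0 < tau)%N.
  rewrite lt0n; apply/eqP => tauE; move: atau.
  by rewrite /a_ /eps tauE powR0 ?oppr_eq0 ?gt_eqF// mulr0 subr0 ltxx andbF.
have t0 : 0 < tau%:R :> R by rewrite ltr0n.
have tT : 0 <= (t_ tau n : R) <= horizon p.
  rewrite /t_ divr_ge0//= ler_pdivrMr// mulrC; apply: le_trans (_ : (N_ p tau)%:R <= _).
    by rewrite ler_nat.
  by rewrite truncn_le// mulr_ge0// ltW.
apply: le_trans (normcB_le _ _) _.
apply: le_trans (lerD (below _ _ _ taut nN zZ) (hM' _ tT)) _.
rewrite -[leLHS]addr0; apply: lerD; last by rewrite mulr_ge0 ?powR_ge0.
apply: (@le_trans _ _ ((B + M') * tau0%:R `^ alpha * tau%:R `^ (- alpha))); last first.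
  by rewrite ler_wpM2r ?powR_ge0// -addrA addrCA lerDl addr_ge0.
rewrite -mulrA ler_peMr// powRN ler_pdivlMr ?powR_gt0// mul1r.
by rewrite ge0_ler_powR ?(ltW a0) ?nnegrE// ler_nat ltnW.
Qed.
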